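(* For every $t\in\mathbb{N}$ there exists a constant $\gamma_t\in\mathbb{N}$ such that for every graph $G$ of twin-width at most $t$ and clique number $\omega$, we have $$\chi(G)\leq 2^{\gamma_t\cdot \log^{4t+3}\omega}.$$
   Context: Graphs are finite, simple and undirected, with at least one vertex. $\chi(G)$ and $\omega(G)$ denote the chromatic number and the clique number (maximum size of a clique). All logarithms are base $2$, and $\log^{p}\omega$ means $(\log\omega)^p$. A pair $A,B$ of disjoint vertex subsets of $G$ is complete if every vertex of $A$ is adjacent to every vertex of $B$, anti-complete if there is no edge between $A$ and $B$, pure if it is complete or anti-complete, and impure otherwise. A vertex partition of $G$ is a partition $\mathcal{P}$ of $V(G)$. Contracting two distinct parts $A,B$ of $\mathcal{P}$ means replacing $A$ and $B$ by the single part $A\cup B$. A contraction sequence for an $n$-vertex graph $G$ is a sequence $\mathcal{P}_1,\ldots,\mathcal{P}_n$ of vertex partitions such that $\mathcal{P}_1$ is the partition into singletons, $\mathcal{P}_n$ is the partition with one part, and $\mathcal{P}_{i+1}$ is obtained from $\mathcal{P}_i$ by contracting two distinct parts, for each $i\in\{1,\ldots,n-1\}$. Its width is the smallest integer $t$ such that for every $i\in\{1,\ldots,n\}$ and every part $A$ of $\mathcal{P}_i$ there are at most $t$ other parts $B$ of $\mathcal{P}_i$ such that $A,B$ is an impure pair. The twin-width of $G$ is the least width of a contraction sequence for $G$. *)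

(* Defs.v *)
From mathcomp Require Import all_boot all_order all_algebra.
From mathcomp Require Import reals exp.

Set Implicit Arguments.
Unset Strict Implicit.
Unset Printing Implicit Defensive.

Record graph := Graph {
  vertex :> finType;
  adj : rel vertex;
  adj_sym : symmetric adj;
  adj_irrefl : irreflexive adj;
  vertex_gt0 : 0 < #|vertex|
}.

Section Graphs.
Variable G : graph.
Implicit Types (x y : G) (A B K : {set G}) (P Q : {set {set G}}).

Definition proper_coloring k (f : {ffun G -> 'I_k}) :=
  [forall x, forall y, adj x y ==> (f x != f y)].

Definition colorable k := [exists f : {ffun G -> 'I_k}, proper_coloring f].

Lemma colorable_ex : exists k, colorable k.
Proof.
exists #|G|; apply/existsP; exists [ffun x => enum_rank x].
apply/forallP=> x; apply/forallP=> y; apply/implyP=> xy; rewrite !ffunE.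
apply/eqP=> /enum_rank_inj exy.
by move: xy; rewrite exy adj_irrefl.
Qed.

Definition chromatic_number := ex_minn colorable_ex.

Definition clique K := [forall x in K, forall y in K, (x != y) ==> adj x y].

Definition clique_number := \max_(K : {set G} | clique K) #|K|.

Definition complete A B := [forall x in A, forall y in B, adj x y].

Definition anticomplete A B := [forall x in A, forall y in B, ~~ adj x y].

Definition pure A B := complete A B || anticomplete A B.

Definition impure A B := ~~ pure A B.

Definition singletons : {set {set G}} := [set [set x] | x : G].

Definition contract P A B : {set {set G}} :=
  (A :|: B) |: (P :\: [set A; B]).

Definition contracts_to P Q :=
  [exists A in P, exists B in P, (A != B) && (Q == contract P A B)].

Definition contraction_sequence (s : #|G|.-tuple {set {set G}}) :=
  [&& all (fun P => partition P [set: G]) s,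
      head set0 s == singletons,
      last set0 s == [set [set: G]]
    & sorted contracts_to s].

Definition impure_degree P A := #|[set B in P | (B != A) && impure A B]|.

Definition width (s : seq {set {set G}}) :=
  \max_(P <- s) \max_(A in P) impure_degree P A.

Lemma width_leP (s : seq {set {set G}}) t :
  reflect (forall P, P \in s -> forall A, A \in P -> impure_degree P A <= t)
          (width s <= t).
Proof.
apply: (iffP (bigmax_leqP_seq _ _ _ _)) => [H P Ps A AP|H P Ps _].
  by move/bigmax_leqP: (H P Ps isT); apply.
by apply/bigmax_leqP=> A AP; apply: H.
Qed.

Lemma singletons_partition : partition singletons [set: G].
Proof.
apply/and3P; split.
- apply/eqP/setP=> x; rewrite !inE; apply/bigcupP; exists [set x].
    exact: imset_f.
  by rewrite inE.
- apply/trivIsetP=> _ _ /imsetP[x _ ->] /imsetP[y _ ->] nxy.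
  rewrite disjoints1 inE; apply: contraNN nxy => /eqP->//.
- apply/negP=> /imsetP[x _] /setP/(_ x); by rewrite !inE eqxx.
Qed.

Lemma card_singletons : #|singletons| = #|G|.
Proof. by rewrite card_imset //; exact: set1_inj. Qed.

Lemma contract_partition P A B : partition P [set: G] ->
  A \in P -> B \in P -> A != B ->
  partition (contract P A B) [set: G] /\ #|contract P A B|.+1 = #|P|.
Proof.
move=> /and3P[/eqP covP /trivIsetP trivP P0] AP BP nAB.
have disj C : C \in P :\: [set A; B] -> [disjoint A :|: B & C].
  rewrite !inE negb_or -andbA => /and3P[CA CB CP].
  by rewrite -setI_eq0 setIUl setU_eq0 !setI_eq0 !trivP // eq_sym.
have A0 : A != set0 by apply: contraNneq P0 => <-.
have nin : A :|: B \notin P :\: [set A; B].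
  apply/negP=> /disj; rewrite -setI_eq0 setIid setU_eq0.
  by rewrite (negbTE A0).
split; last first.
  rewrite /contract cardsU1 nin cardsD (setIidPr _) ?cards2 ?nAB; last first.
    by apply/subsetP=> C; rewrite !inE => /orP[]/eqP->.
  have : #|[set A; B]| <= #|P|.
    by apply/subset_leq_card/subsetP=> C; rewrite !inE => /orP[]/eqP->.
  by rewrite cards2 nAB => h; rewrite add1n -subSn // -subSn ?subSS ?subn0 // ltnW.
apply/and3P; split.
- apply/eqP/setP=> x; rewrite [RHS]inE; apply/bigcupP.
  have /bigcupP[C CP xC] : x \in cover P by rewrite covP inE.
  have [CAB|nCAB] := boolP (C \in [set A; B]).
    exists (A :|: B); first by rewrite /contract !inE eqxx.
    by move: CAB; rewrite !inE => /orP[]/eqP <-; rewrite xC ?orbT.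
  by exists C; rewrite // /contract in_setU1 in_setD nCAB CP orbT.
- apply/trivIsetP=> C D; rewrite /contract !in_setU1.
  move=> /orP[/eqP->|CP] /orP[/eqP->|DP]; rewrite ?eqxx // => nCD.
  + exact: disj.
  + by rewrite disjoint_sym; apply: disj.
  + by move: CP DP; rewrite !inE => /andP[_ ?] /andP[_ ?]; apply: trivP.
- rewrite /contract in_setU1 in_setD negb_or (negbTE P0) andbF andbT.
  by rewrite eq_sym setU_eq0 (negbTE A0).
Qed.

Lemma contraction_sequence_from k P : partition P [set: G] -> #|P| = k.+1 ->
  exists s, [/\ size s = k, all (fun P => partition P [set: G]) (P :: s),
             last P s = [set [set: G]] & path contracts_to P s].
Proof.
elim: k P => [|k IH] P partP cardP.
  have /cards1P[A eP] := introT eqP cardP.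
  exists [::]; split=> //=; first by rewrite partP.
  by have := cover_partition partP; rewrite eP /cover big_set1 => ->.
have /card_gt1P[A [B [AP BP nAB]]] : 1 < #|P| by rewrite cardP.
have [partQ] := contract_partition partP AP BP nAB.
rewrite cardP => -[cardQ].
have [s [ss alls lasts paths]] := IH _ partQ cardQ.
exists (contract P A B :: s); split=> //; first by rewrite /= ss.
  by rewrite /= partP.
rewrite /= paths andbT; apply/existsP; exists A; rewrite AP.
by apply/existsP; exists B; rewrite BP nAB eqxx.
Qed.

Lemma contraction_sequence_ex : exists s, contraction_sequence s.
Proof.
have cS : #|singletons| = #|G|.-1.+1 by rewrite card_singletons prednK ?vertex_gt0.
have [s [ss alls lasts paths]] :=
  contraction_sequence_from singletons_partition cS.
have sz : size (singletons :: s) == #|G| by rewrite /= ss prednK ?vertex_gt0.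
exists (Tuple sz); apply/and4P; split=> //=.
exact/eqP.
Qed.

Lemma contraction_width_ex :
  exists t, [exists s, contraction_sequence s && (width s == t)].
Proof.
have [s cs] := contraction_sequence_ex.
by exists (width s); apply/existsP; exists s; rewrite cs eqxx.
Qed.

Definition twin_width := ex_minn contraction_width_ex.

End Graphs.

Definition log2 (R : realType) (x : R) : R := (ln x / ln 2)%R.

(* Main.v *)
Require Import Defs.
From mathcomp Require Import all_boot all_order all_algebra.
From mathcomp Require Import reals exp.
From mathcomp Require Import zify.

(** Why the bound holds.

    Order the vertices so that every part of a contraction sequence of width
    [t] is an interval.  If [2 * t + 5] successive sets of vertices were
    pairwise mixed (each contains a vertex that sees the other set
    non-uniformly), look at the first part [Z] that swallows one of them.  All
    the sets, except at most four that [Z] meets, contain a vertex that splits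
    [Z], and hence meet a part impure to [Z]; but there are at most [t] such parts
    and each of them meets at most two of the sets
    ([twin_width_minor_free]).  So it is enough to color ordered graphs without
    [D] successive pairwise mixed sets, by induction on [D]
    ([coloring_bound]).  The induction needs graphs in which several pairwise
    non-adjacent vertices may occupy the same position, because it coarsens
    the order and forgets the edges inside the classes.

    Let [omega < 2 ^ n.+1].  Cut off the shortest prefix [L] and the shortest
    suffix [R] with clique number at least [2 ^ n].  These, and the vertices
    complete to [L] or to [R], are covered by a bounded number of sets of clique
    number less than [2 ^ n] ([peel_prefix]), so only the middle part [W]
    matters, none of whose vertices is complete to [L] or to [R].

    Decompose [W] by a tree of intervals: the children of an interval [y] are,
    up to degenerate cases, its maximal subintervals to which every vertex outside
    [y] is complete or anticomplete.  Two vertices of different children enclose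
    vertices of [y] that are distinguished from the left or from the right of
    [y].  Since no vertex of [W] is complete to the part of the graph on the left
    of [y], nor to the one on the right, a subset of [y] that contains two vertices
    distinguished by the left side is mixed with that side, which can therefore
    be added as one more block to any family of such pairwise mixed subsets.
    After a coarsening of the order that makes all blocks of this kind, the edges
    between different children form graphs without [D - 1] successive mixed
    sets, and are properly colored by induction
    ([cross_coloring], [child_coloring]).

    It remains to combine these colorings along the tree
    ([tree_coloring]).  Call a node big if its clique number is at least [2 ^ n].
    Two big sets are never complete to each other, and grandchildren of a node
    that have different parents are complete or anticomplete to each other.  So
    an edge of [W] either lies in a small node, or joins vertices that are at
    most three levels away from a common node where their colors differ, or goes
    from a vertex to one deep inside a big node to which the first is complete; in
    that case the clique number of the set of vertices complete to the current node
    has increased.  Recording this clique number, three levels of colors, and a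
    coloring of the small node multiplies the bound for [n] by [2 ^ n] times a
    power of the bound for [D - 1]; iterating over [n] raises the degree of the
    exponent by one for each value of [D], and [D = 2 * t + 5] gives the exponent
    [2 * t + 5], which is at most [4 * t + 3] once [0 < t].  For [t = 0] all parts
    of all partitions are pure, and the chromatic number equals the clique
    number ([pure_sequence_colorable]). *)

Set Implicit Arguments.
Unset Strict Implicit.
Unset Printing Implicit Defensive.

(** * Clique number and colorings of vertex sets *)

Definition is_clique (V : finType) (e : rel V) (K : {set V}) :=
  [forall x in K, forall y in K, (x != y) ==> e x y].

Definition omega (V : finType) (e : rel V) (S : {set V}) :=
  \max_(K : {set V} | is_clique e K && (K \subset S)) #|K|.

Lemma is_cliqueP (V : finType) (e : rel V) (K : {set V}) :
  reflect {in K &, forall x y, x != y -> e x y} (is_clique e K).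
Proof.
apply: (iffP forall_inP) => [H x y xK yK xy|H x xK].
  by have /forall_inP/(_ y yK)/implyP := H x xK; apply.
by apply/forall_inP => y yK; apply/implyP; apply: H.
Qed.

Lemma leq_omega (V : finType) (e : rel V) (S K : {set V}) :
  is_clique e K -> K \subset S -> #|K| <= omega e S.
Proof.
by move=> cK KS; apply: (@bigmax_sup _ K _ #|K| (fun K => #|K|)); rewrite ?cK.
Qed.

Lemma omega_leP (V : finType) (e : rel V) (S : {set V}) m :
  reflect (forall K : {set V}, is_clique e K -> K \subset S -> #|K| <= m)
          (omega e S <= m).
Proof.
apply: (iffP (bigmax_leqP _ _ _)) => [H K cK KS|H K /andP[cK KS]].
  by apply: H; rewrite cK.
exact: H.
Qed.

Lemma omega_witness (V : finType) (e : rel V) (S : {set V}) :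
  exists K : {set V}, [/\ is_clique e K, K \subset S & #|K| = omega e S].
Proof.
have [|K /andP[cK KS] eK] :=
  @eq_bigmax_cond _ (fun K : {set V} => is_clique e K && (K \subset S))
                  (fun K => #|K|).
  apply/card_gt0P; exists set0; rewrite unfold_in sub0set andbT.
  by apply/is_cliqueP => x y; rewrite inE.
by exists K; split.
Qed.

Lemma omega_sub (V : finType) (e e' : rel V) (S T : {set V}) :
  {in S &, subrel e e'} -> S \subset T -> omega e S <= omega e' T.
Proof.
move=> ee' ST; apply/omega_leP => K /is_cliqueP cK KS.
apply: leq_omega (subset_trans KS ST); apply/is_cliqueP => x y xK yK xy.
by apply: ee'; rewrite ?(subsetP KS) //; apply: cK.
Qed.

Lemma omegaS (V : finType) (e : rel V) (S T : {set V}) :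
  S \subset T -> omega e S <= omega e T.
Proof. by apply: omega_sub => x y _ _. Qed.

(** A clique of [A] and a clique of [B] combine.  This is the only source of
    decrease of the clique number: what is complete to a set of large clique
    number has a small one. *)
Lemma omega_join (V : finType) (e : rel V) (A B S : {set V}) :
  symmetric e -> irreflexive e -> A \subset S -> B \subset S ->
  {in A & B, forall a b, e a b} -> omega e A + omega e B <= omega e S.
Proof.
move=> e_sym e_irr AS BS AB.
have [K [/is_cliqueP cK KA <-]] := omega_witness e A.
have [L [/is_cliqueP cL LB <-]] := omega_witness e B.
have KL : [disjoint K & L].
  rewrite -setI_eq0; apply/eqP/setP => x; rewrite !inE; apply/negP => /andP[xK xL].
  by have := AB x x (subsetP KA x xK) (subsetP LB x xL); rewrite e_irr.
have -> : #|K| + #|L| = #|K :|: L|.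
  by move: KL; rewrite -setI_eq0 => /eqP KL; rewrite cardsU KL cards0 subn0.
apply: leq_omega; last first.
  by rewrite subUset (subset_trans KA AS) (subset_trans LB BS).
apply/is_cliqueP => x y; rewrite !inE => /orP[xK|xL] /orP[yK|yL] xy.
- exact: cK.
- by apply: AB; [exact: (subsetP KA)|exact: (subsetP LB)].
- by rewrite e_sym; apply: AB; [exact: (subsetP KA)|exact: (subsetP LB)].
- exact: cL.
Qed.

Lemma omega_gt0 (V : finType) (e : rel V) (S : {set V}) x :
  x \in S -> 0 < omega e S.
Proof.
move=> xS; rewrite -(cards1 x); apply: leq_omega; last by rewrite sub1set.
by apply/is_cliqueP => a b; rewrite !inE => /eqP-> /eqP->; rewrite eqxx.
Qed.

Lemma omega_gt1 (V : finType) (e : rel V) (S : {set V}) x y :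
  symmetric e -> irreflexive e -> x \in S -> y \in S -> e x y -> 1 < omega e S.
Proof.
move=> e_sym e_irr xS yS xy.
have nxy : x != y by apply: contraTneq xy => ->; rewrite e_irr.
have c2 : 1 < #|[set x; y]| by rewrite cards2 nxy.
apply: leq_trans c2 (leq_omega _ _).
  apply/is_cliqueP => a b; rewrite !inE => /orP[]/eqP-> /orP[]/eqP->;
  by rewrite ?eqxx // => _; rewrite // e_sym.
by apply/subsetP => z; rewrite !inE => /orP[]/eqP->.
Qed.

Lemma omega_gt1P (V : finType) (e : rel V) (S : {set V}) :
  1 < omega e S -> exists x y, [/\ x \in S, y \in S & e x y].
Proof.
have [K [/is_cliqueP cK KS <-]] := omega_witness e S.
move=> /card_gt1P[x [y [xK yK xy]]]; exists x, y.
by split; rewrite ?(subsetP KS) //; apply: cK.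
Qed.

(** Colors are natural numbers, so that palettes of different sizes can be
    juxtaposed or multiplied by plain arithmetic. *)
Definition colorable_in (V : finType) (e : rel V) (S : {set V}) (k : nat) :=
  exists f : V -> nat, {in S, forall u, f u < k} /\
                       {in S &, forall u v, e u v -> f u <> f v}.

Lemma colorable_le (V : finType) (e : rel V) (S T : {set V}) k l :
  S \subset T -> k <= l -> colorable_in e T k -> colorable_in e S l.
Proof.
move=> /subsetP ST kl [f [fk fp]]; exists f; split=> [u /ST uT|u v /ST uT /ST vT].
  exact: leq_trans (fk u uT) kl.
exact: fp.
Qed.

Lemma colorableU (V : finType) (e : rel V) (S A B : {set V}) k l :
  S \subset A :|: B -> colorable_in e A k -> colorable_in e B l ->
  colorable_in e S (k + l).
Proof.
move=> SAB [f [fk fp]] [g [gl gp]].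
exists (fun u => if u \in A then f u else k + g u).
have inB u : u \in S -> u \notin A -> u \in B.
  by move=> /(subsetP SAB); rewrite inE => /orP[->|].
split=> [u uS|u v uS vS uv].
  case: ifPn => uA; first by apply: leq_trans (fk u uA) _; apply: leq_addr.
  by rewrite ltn_add2l; apply/gl/inB.
case: ifPn => uA; case: ifPn => vA.
- exact: fp.
- by have := fk u uA; lia.
- by have := fk v vA; lia.
- by move=> /addnI; apply: gp => //; exact: inB.
Qed.

Lemma colorable_independent (V : finType) (e : rel V) (S : {set V}) :
  {in S &, forall u v, ~~ e u v} -> colorable_in e S 1.
Proof.
move=> indS; exists (fun=> 0); split=> // u v uS vS uv.
by have := indS u v uS vS; rewrite uv.
Qed.

(** Product palettes: the pair [(a, b)] with [b < l] is encoded as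
    [a * l + b]. *)
Lemma pair_code_lt a b k l : a < k -> b < l -> a * l + b < k * l.
Proof.
move=> ak bl; apply: (@leq_trans (a.+1 * l)); last by rewrite leq_mul2r ak orbT.
by rewrite mulSn addnC ltn_add2r.
Qed.

Lemma pair_code_inj a b a' b' l : b < l -> b' < l ->
  a * l + b = a' * l + b' -> a = a' /\ b = b'.
Proof.
move=> bl bl' E; have l0 : 0 < l by exact: leq_ltn_trans bl.
have ea : a = a'.
  have := congr1 (divn^~ l) E.
  by rewrite /= !divnMDl // !divn_small // !addn0.
by split=> //; move: E; rewrite ea => /addnI.
Qed.

(** * Coloring along a decomposition tree *)

Definition uniform_on (V : finType) (e : rel V) (K : {set V}) (x : V) :=
  {in K &, forall a b, e x a = e x b}.

(** The decomposition is given abstractly by the function [child]: [child y u]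
    is the child of the node [y] that contains [u].  Only big nodes are
    decomposed; a small node gets the coloring [inner].  The two facts that make
    the combination work are that the vertices outside [y] are constant on each
    child of [y] ([child_agree]), and that [c y] separates the ends of an edge
    between different children of [y] ([c_proper]). *)
Section Tree.
Variables (V : finType) (e : rel V) (W : {set V}) (n q h : nat).
Variables (child : {set V} -> V -> {set V}) (c : {set V} -> V -> nat).
Variables (inner : {set V} -> V -> nat) (node : {set V} -> Prop).
Hypothesis e_sym : symmetric e.
Hypothesis e_irr : irreflexive e.
Hypothesis omW : omega e W < 2 ^ n.+1.
Hypothesis nodeW : node W.
Let big y := 2 ^ n <= omega e y.
Hypothesis child_mem : forall y u, node y -> big y -> u \in y -> u \in child y u.
Hypothesis child_proper : forall y u, node y -> big y -> u \in y -> child y u \proper y.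
Hypothesis child_node : forall y u, node y -> big y -> u \in y -> big (child y u) ->
  node (child y u).
Hypothesis child_eq : forall y u v, node y -> big y -> u \in y ->
  v \in child y u -> child y v = child y u.
Hypothesis child_agree : forall y u x, node y -> big y -> u \in y ->
  x \in W :\: y -> uniform_on e (child y u) x.
Hypothesis c_lt : forall y u, node y -> big y -> u \in y -> c y u < q.
Hypothesis c_proper : forall y u v, node y -> big y -> u \in y -> v \in y ->
  e u v -> child y u != child y v -> c y u <> c y v.
Hypothesis inner_proper : forall y : {set V}, y \subset W -> ~~ big y ->
  {in y, forall u, inner y u < h} /\
  {in y &, forall u v, e u v -> inner y u <> inner y v}.

(** The branch of the tree that follows [u]; it becomes stationary at the first
    small node. *)
Fixpoint desc u k : {set V} :=
  if k is k'.+1 then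
    let y := desc u k' in if big y then child y u else y
  else W.

Lemma desc_spec u k : u \in W ->
  [/\ u \in desc u k, desc u k \subset W & big (desc u k) -> node (desc u k)].
Proof.
move=> uW; elim: k => [|k [IH1 IH2 IH3]] //=.
case: ifPn => // bk; have nk := IH3 bk; split.
- exact: child_mem.
- exact: subset_trans (proper_sub (child_proper nk bk IH1)) IH2.
- exact: child_node.
Qed.

Lemma descS u k : u \in W -> big (desc u k) -> desc u k.+1 = child (desc u k) u.
Proof. by move=> uW bk /=; rewrite bk. Qed.

Lemma desc_sub u i j : u \in W -> i <= j -> desc u j \subset desc u i.
Proof.
move=> uW /subnK <-; elim: (j - i) => [|k IH] //=.
apply: subset_trans IH; case: ifPn => // bk.
have [um _ /(_ bk) nk] := desc_spec (k + i) uW.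
exact: proper_sub (child_proper nk bk um).
Qed.

Lemma desc_eq u v k : u \in W -> v \in desc u k -> desc v k = desc u k.
Proof.
move=> uW; elim: k => [|k IH] //= vk.
have [um _ nk] := desc_spec k uW.
have vk' : v \in desc u k by apply: (subsetP (desc_sub uW (leqnSn k))).
rewrite (IH vk'); move: vk; case: ifPn => // bk vk.
exact: (child_eq (nk bk) bk um vk).
Qed.

(** The first alternative makes [depth] total. *)
Lemma ex_small u : exists k, (u \notin W) || ~~ big (desc u k).
Proof.
have [uW|] := boolP (u \in W); last by exists 0.
exists #|W|.+1 => /=; apply/negP => b.
have card_desc k : big (desc u k) -> #|desc u k| + k <= #|W|.
  elim: k => [|k IH] //=; first by rewrite addn0.
  case: ifPn => [bk _|/negP//].
  have [um _ /(_ bk) nk] := desc_spec k uW.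
  by have := proper_card (child_proper nk bk um); have := IH bk; lia.
have [u1 _ _] := desc_spec #|W|.+1 uW.
have := card_desc #|W|.+1 b; lia.
Qed.

Definition depth u := ex_minn (ex_small u).

Lemma depth_small u : u \in W -> ~~ big (desc u (depth u)).
Proof. by rewrite /depth => uW; case: ex_minnP => k; rewrite uW. Qed.

Lemma depth_big u k : u \in W -> k < depth u -> big (desc u k).
Proof.
rewrite /depth; case: ex_minnP => m _ minm uW; apply: contraTT => bk.
by rewrite -leqNgt; apply: minm; rewrite bk orbT.
Qed.

Lemma big_depth u k : u \in W -> (forall i, i <= k -> big (desc u i)) -> k < depth u.
Proof.
move=> uW H; rewrite ltnNge; apply/negP => /H; apply/negP; exact: depth_small.
Qed.

(** Along a branch these sets grow, while their clique number stays below
    [2 ^ n] as long as the node is big ([above_lt]): this is the quantity that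
    increases along the deep edges. *)
Definition above (y : {set V}) := [set w in W | [forall x in y, e w x]].

Lemma aboveP (y : {set V}) w : reflect (w \in W /\ {in y, forall x, e w x}) (w \in above y).
Proof. by rewrite inE; apply: (iffP andP) => -[? /forall_inP]. Qed.

Lemma above_sub (y z : {set V}) : y \subset z -> above z \subset above y.
Proof.
move=> /subsetP yz; apply/subsetP => w /aboveP[wW wz].
by apply/aboveP; split=> // x /yz; apply: wz.
Qed.

Lemma above_lt (y : {set V}) : y \subset W -> big y -> omega e (above y) < 2 ^ n.
Proof.
move=> yW bY; have : omega e (above y) + omega e y <= omega e W.
  apply: omega_join => //; first by apply/subsetP => w /aboveP[].
  by move=> a b /aboveP[_]; apply.
by move: bY omW; rewrite /big expnS; lia.
Qed.

(** The nodes of the branch whose colors are recorded are the last three big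
    ones.  They are indexed by their level modulo three, so that two branches that
    share one of them as a recorded node record it at the same index. *)
Definition level_color i u :=
  let k := (depth u - 1 - i) %/ 3 * 3 + i in
  if k < depth u then c (desc u k) u else 0.

(** The level [depth u - 2] is the parent of the last big node of the branch: with
    it, a branch that leaves a common node at most two levels before becoming small
    has a rank bounded by that of the common node, and a branch that continues for
    at least four levels has a rank bounded below by that of a grandchild of the
    common node ([rank_step]). *)
Definition rank u :=
  if 1 < depth u then omega e (above (desc u (depth u - 2))) else 0.

Lemma level_colorE u k : k < depth u <= k + 3 ->
  level_color (k %% 3) u = c (desc u k) u.
Proof.
move=> kd; rewrite /level_color.
suff -> : (depth u - 1 - k %% 3) %/ 3 * 3 + k %% 3 = k by case/andP: kd => ->.
lia.
Qed.

Hypothesis q0 : 0 < q.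

Lemma level_color_lt i u : u \in W -> level_color i u < q.
Proof.
move=> uW; rewrite /level_color; case: ifP => // kd.
have bk := depth_big uW kd; have [um _ nk] := desc_spec ((depth u - 1 - i) %/ 3 * 3 + i) uW.
exact: c_lt (nk bk) bk um.
Qed.

Lemma rank_lt u : u \in W -> rank u < 2 ^ n.
Proof.
move=> uW; rewrite /rank; case: ifP => [d1|_]; last by rewrite expn_gt0.
have [_ dW _] := desc_spec (depth u - 2) uW.
by apply: above_lt dW (depth_big uW _); lia.
Qed.

(** The last common node of two branches. *)
Lemma branch u v : u \in W -> v \in W -> v \notin desc u (depth u) ->
  exists k, [/\ k < depth u, k < depth v, desc u k = desc v k,
    v \notin desc u k.+1 & u \notin desc v k.+1].
Proof.
move=> uW vW nv; have ex : exists j, v \notin desc u j by exists (depth u).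
case: (ex_minnP ex) => -[|k] nvk mink; first by case/negP: nvk.
have vk i : i <= k -> v \in desc u i.
  move=> ik; have [//|nvi] := boolP (v \in desc u i).
  by have := mink _ nvi; rewrite ltnNge ik.
have du : k < depth u by apply: mink nv.
have ek i : i <= k -> desc v i = desc u i by move=> ik; apply/desc_eq/vk.
exists k; split=> //.
- apply: big_depth => // i ik; rewrite ek //; apply: depth_big => //.
  exact: leq_ltn_trans du.
- by rewrite ek.
- apply: contra nvk => uk; rewrite (desc_eq vW uk).
  by have [] := desc_spec k.+1 vW.
Qed.

(** The grandchild containing [v] of the last common node is a child of a node
    that does not contain [u], so [u] is constant on it. *)
Lemma branch_complete u v k : u \in W -> v \in W -> e u v ->
  k < depth u -> k < depth v -> v \notin desc u k.+1 -> u \notin desc v k.+1 ->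
  k.+1 < depth v -> {in desc v k.+2, forall b, e u b}.
Proof.
move=> uW vW uv du dv nvu nuv dv' b.
have bv := depth_big vW dv'; rewrite (descS vW bv) => bb.
have [vm _ /(_ bv) nv] := desc_spec k.+1 vW.
rewrite (@child_agree _ v u nv bv vm _ b v) //; first by rewrite inE nuv.
exact: child_mem.
Qed.

(** [u] is adjacent to everything complete to the common node, and is itself
    complete to the grandchild containing [v]: it extends each clique complete to
    the common node to a larger one complete to that grandchild. *)
Lemma rank_step u v k : u \in W -> v \in W -> e u v ->
  k < depth u <= k.+2 -> k + 4 <= depth v -> desc u k = desc v k ->
  v \notin desc u k.+1 -> u \notin desc v k.+1 -> rank u < rank v.
Proof.
move=> uW vW uv /andP[du du2] dv eqk nvu nuv.
have uC : {in desc v k.+2, forall b, e u b}.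
  by apply: (branch_complete uW vW uv) => //; lia.
have -> : rank v = omega e (above (desc v (depth v - 2))).
  by rewrite /rank ifT //; lia.
apply: (@leq_trans (omega e (above (desc v k.+2)))); last first.
  by apply/omegaS/above_sub/desc_sub => //; lia.
apply: (@leq_ltn_trans (omega e (above (desc v k)))).
  rewrite /rank; case: ifP => // du1; rewrite -eqk.
  by apply/omegaS/above_sub/desc_sub => //; lia.
have uk : u \in desc v k by rewrite -eqk; have [] := desc_spec k uW.
apply: (@leq_trans (omega e (above (desc v k)) + omega e [set u])).
  by rewrite -addn1 leq_add2l (@omega_gt0 _ _ _ u) ?inE.
apply: omega_join => //.
- by apply/above_sub/desc_sub => //; lia.
- by rewrite sub1set; apply/aboveP.
- by move=> a b /aboveP[_ H]; rewrite inE => /eqP->; apply: H.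
Qed.

(** If both branches stayed big at level [k.+2], the two nodes there would be
    complete to each other, since each of them is seen uniformly from outside its
    parent, and their clique numbers would add up to at least [2 ^ n.+1]. *)
Lemma branch_shallow u v k : u \in W -> v \in W -> e u v ->
  k < depth u -> k < depth v -> desc u k = desc v k ->
  v \notin desc u k.+1 -> u \notin desc v k.+1 ->
  (depth u <= k.+2) || (depth v <= k.+2).
Proof.
move=> uW vW uv du dv eqk nvu nuv; rewrite -[_ || _]negbK negb_or -!ltnNge.
apply/negP => /andP[du2 dv2].
have [_ duW _] := desc_spec k.+2 uW; have [_ dvW _] := desc_spec k.+2 vW.
have : omega e (desc u k.+2) + omega e (desc v k.+2) <= omega e W.
  apply: omega_join => // a b ad bd.
  have ad1 := subsetP (desc_sub uW (leqnSn k.+1)) a ad.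
  have bd1 := subsetP (desc_sub vW (leqnSn k.+1)) b bd.
  have aW := subsetP duW a ad; have bW := subsetP dvW b bd.
  have bv := depth_big vW (ltnW dv2); have bu := depth_big uW (ltnW du2).
  have va : e v a.
    by apply: (branch_complete vW uW _ dv du nuv nvu (ltnW du2)); rewrite // e_sym.
  move: bd; rewrite (descS vW bv) => bd.
  have [vm _ /(_ bv) nv] := desc_spec k.+1 vW.
  rewrite (@child_agree _ v a nv bv vm _ b v) //.
  - by rewrite e_sym.
  - rewrite inE aW andbT; apply: contra nvu => av.
    rewrite -(desc_eq uW ad1) (desc_eq vW av); by have [] := desc_spec k.+1 vW.
  - exact: child_mem.
have bu := depth_big uW du2; have bv := depth_big vW dv2.
by move: bu bv omW; rewrite /big expnS; lia.
Qed.

Definition tree_color u :=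
  (((rank u * q + level_color 0 u) * q + level_color 1 u) * q
     + level_color 2 u) * h + inner (desc u (depth u)) u.

(** An edge inside a small node is handled by [inner]; one that splits at most
    three levels above both final nodes by a recorded color; for the others,
    [branch_shallow] makes one end shallow, and the ranks differ. *)
Lemma tree_coloring : colorable_in e W (2 ^ n * q * q * q * h).
Proof.
have inner_lt u : u \in W -> inner (desc u (depth u)) u < h.
  move=> uW; have [um dW _] := desc_spec (depth u) uW.
  by have [H _] := inner_proper dW (depth_small uW); apply: H.
exists tree_color; split=> [u uW|u v uW vW uv].
  by rewrite /tree_color !pair_code_lt ?level_color_lt ?rank_lt ?inner_lt.
move=> /pair_code_inj[||/pair_code_inj[||/pair_code_inj[||/pair_code_inj[||]]]];
  rewrite ?level_color_lt ?inner_lt //.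
move=> eqr eq0 eq1 eq2 eqi.
have [vu|nvu] := boolP (v \in desc u (depth u)).
  have du : depth v = depth u.
    apply/eqP; rewrite eqn_leq andbC; apply/andP; split.
      rewrite leqNgt; apply/negP => dlt.
      have := depth_small vW; rewrite (@desc_eq u v) ?depth_big //.
      by apply: subsetP vu; apply/desc_sub => //; apply: ltnW.
    rewrite leqNgt; apply/negP => dlt; have := depth_big vW dlt.
    by rewrite (desc_eq uW vu); apply/negP/depth_small.
  move: eqi; rewrite du (desc_eq uW vu).
  have [um dW _] := desc_spec (depth u) uW.
  by have [_ H] := inner_proper dW (depth_small uW); apply: H.
have [k [du dv eqk nvk nuk]] := branch uW vW nvu.
have eql i : i < 3 -> level_color i u = level_color i v by case: i => [|[|[|]]].
have [close|far] := boolP ((depth u <= k + 3) && (depth v <= k + 3)).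
  case/andP: close => cu cv.
  have := eql (k %% 3) (ltn_pmod k (isT : 0 < 3)); rewrite !level_colorE ?du ?dv // -eqk.
  have bk := depth_big uW du; have [um _ /(_ bk) nk] := desc_spec k uW.
  have vm : v \in desc u k by rewrite eqk; have [] := desc_spec k vW.
  apply: c_proper => //; apply: contraNneq nvk => ec.
  by rewrite (descS uW bk) ec; apply: child_mem.
have /orP[su|sv] := branch_shallow uW vW uv du dv eqk nvk nuk.
  have := @rank_step u v k uW vW uv; rewrite du su eqr ltnn => H.
  by suff: false by []; apply: H => //; lia.
have := @rank_step v u k vW uW; rewrite dv sv -eqr ltnn e_sym => H.
by suff: false by []; apply: H => //; lia.
Qed.
End Tree.

(** * Mixed minors and edges across a coarsened order *)

Definition splits (V : finType) (e : rel V) (A B : {set V}) :=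
  [exists a in A, exists b in B, exists b' in B, e a b != e a b'].

Definition mixed (V : finType) (e : rel V) (A B : {set V}) :=
  splits e A B && splits e B A.

Definition before (V : finType) (pos : V -> nat) (A B : {set V}) :=
  [forall a in A, forall b in B, pos a < pos b].

(** The blocks need not be intervals, but any separated family of sets extends to
    one of intervals: mixedness is preserved by enlarging the blocks. *)
Definition mixed_minor (V : finType) (e : rel V) (pos : V -> nat)
    (s : seq {set V}) :=
  (set0 \notin s) && pairwise (fun A B => before pos A B && mixed e A B) s.

Definition minor_free (V : finType) (e : rel V) (pos : V -> nat) D (S : {set V}) :=
  forall s, mixed_minor e pos s -> all (fun B : {set V} => B \subset S) s ->
  size s < D.

(** Vertices at the same position are pairwise non-adjacent; a position is thus
    an indivisible independent class, as it arises from coarsening an order. *)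
Definition proper_pos (V : finType) (e : rel V) (pos : V -> nat) :=
  forall u v, e u v -> pos u != pos v.

Lemma splitsP (V : finType) (e : rel V) (A B : {set V}) :
  reflect (exists a b b', [/\ a \in A, b \in B, b' \in B & e a b != e a b'])
          (splits e A B).
Proof.
apply: (iffP exists_inP) => [[a aA /exists_inP[b bB /exists_inP[b' bB' H]]]|].
  by exists a, b, b'.
move=> [a [b [b' [aA bB bB' H]]]]; exists a => //; apply/exists_inP.
by exists b => //; apply/exists_inP; exists b'.
Qed.

Lemma beforeP (V : finType) (pos : V -> nat) (A B : {set V}) :
  reflect {in A & B, forall a b, pos a < pos b} (before pos A B).
Proof.
apply: (iffP forall_inP) => [H a b aA bB|H a aA].
  exact: (forall_inP (H a aA)).
by apply/forall_inP => b; apply: H.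
Qed.

Lemma splitsS (V : finType) (e : rel V) (A A' B B' : {set V}) :
  A \subset A' -> B \subset B' -> splits e A B -> splits e A' B'.
Proof.
move=> /subsetP AA' /subsetP BB' /splitsP[a [b [b' [aA bB b'B H]]]].
by apply/splitsP; exists a, b, b'; split; auto.
Qed.

Lemma minor_freeS (V : finType) (e : rel V) (pos : V -> nat) D (S T : {set V}) :
  S \subset T -> minor_free e pos D T -> minor_free e pos D S.
Proof.
move=> ST H s ms sS; apply: H => //; apply: sub_all sS => B BS.
exact: subset_trans ST.
Qed.

Lemma proper_pos_irr (V : finType) (e : rel V) (pos : V -> nat) :
  proper_pos e pos -> irreflexive e.
Proof. by move=> H u; apply/negP => /H; rewrite eqxx. Qed.

(** Cut the positions greedily from the left: a class is closed just before it
    would satisfy [P].  A class then satisfies [P] only if it is a single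
    position, and the union of two consecutive classes always does. *)
Lemma greedy_classes (P : nat -> nat -> bool) :
  (forall i' i j j', i' <= i -> j <= j' -> P i j -> P i' j') ->
  exists phi : nat -> nat,
    [/\ {homo phi : i j / i <= j},
        forall i j, i < j -> P i j -> phi i < phi j &
        forall p k, phi p = k.+1 ->
          exists i j, [/\ phi i = k, phi j = k.+1 & P i j]].
Proof.
move=> Pmono.
pose g := fix g p := if p is p'.+1 then
  (if P (g p').2 p'.+1 then ((g p').1.+1, p'.+1) else g p') else (0, 0).
have gS p : g p.+1 = if P (g p).2 p.+1 then ((g p).1.+1, p.+1) else g p by [].
have mono : {homo (fun p => (g p).1) : i j / i <= j}.
  move=> i j /subnK <-; elim: (j - i) => [|d IH] //; rewrite addSn gS.
  by case: ifP => _ //=; apply: leqW.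
have start p : [/\ (g p).2 <= p, (g (g p).2).1 = (g p).1 &
                   ((g p).2 == p) || ~~ P (g p).2 p].
  elim: p => [|p [IH1 IH2 IH3]] //; rewrite gS.
  case: ifPn => [Pt|nP]; last by split=> //; [exact: leqW|rewrite nP orbT].
  by split=> //; [rewrite gS Pt|rewrite eqxx].
have same i j : i <= j -> (g i).1 = (g j).1 -> (g i).2 = (g j).2.
  move=> /subnK <-; elim: (j - i) => [|d IH] //; rewrite addSn gS.
  have := mono i (d + i) (leq_addl _ _); case: ifP => _ /= le_ij; last exact: IH.
  by move=> E; rewrite E ltnn in le_ij.
exists (fun p => (g p).1); split=> //.
- move=> i j ij Pij; rewrite ltn_neqAle mono ?(ltnW ij) // andbT.
  apply/eqP => /(same _ _ (ltnW ij)) E.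
  have [si _ _] := start i; have [sj _ /orP[/eqP|/negP[]]] := start j.
    by rewrite -E; lia.
  by apply: Pmono Pij; rewrite -?E.
- elim=> [|p IH] k //; rewrite gS; case: ifPn => [Ps|_]; last exact: IH.
  move=> /= [<-]; exists (g p).2, p.+1.
  by have [_ -> _] := start p; rewrite gS Ps.
Qed.

Lemma half_lt_pred a b : odd a = odd b -> a./2 < b./2 -> a < b.-1.
Proof.
by have := odd_double_half a; have := odd_double_half b; move=> eb ea oab; lia.
Qed.

(** The set [A] precedes [y], and no vertex of [y] is complete to it.  The edges
    of [y] whose span contains two vertices distinguished by [A] are colored with
    about twice as many colors as suffice without [D] mixed blocks, although
    only [D.+1] blocks are excluded: the set [A] serves as an additional block. *)
Section Cross.
Variables (V : finType) (e : rel V) (pos : V -> nat) (D N k : nat).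
Variables (S A y : {set V}).
Hypothesis D0 : 0 < D.
Hypothesis e_sym : symmetric e.
Hypothesis e_pos : proper_pos e pos.
Hypothesis colorD : forall (e' : rel V) (pos' : V -> nat) (S' : {set V}),
  symmetric e' -> proper_pos e' pos' -> omega e' S' < N ->
  minor_free e' pos' D S' -> colorable_in e' S' k.
Hypothesis free : minor_free e pos D.+1 S.
Hypothesis AS : A \subset S.
Hypothesis yS : y \subset S.
Hypothesis Ay : before pos A y.
Hypothesis noncomplete : {in y, forall u, exists2 w, w \in A & ~~ e w u}.
Hypothesis omy : omega e y < N.

Definition distinguishes i j (x : V) (a b : V) :=
  [&& i <= pos a <= j, i <= pos b <= j & e x a != e x b].

Definition cross_split i j :=
  [exists x in A, exists a in y, exists b in y, distinguishes i j x a b].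

Lemma cross_splitP i j :
  reflect (exists x a b, [/\ x \in A, a \in y, b \in y & distinguishes i j x a b])
          (cross_split i j).
Proof.
apply: (iffP exists_inP) => [[a aA /exists_inP[b bB /exists_inP[b' bB' H]]]|].
  by exists a, b, b'.
move=> [a [b [b' [aA bB bB' H]]]]; exists a => //; apply/exists_inP.
by exists b => //; apply/exists_inP; exists b'.
Qed.

(** A single greedy class may be homogeneous to [A], hence not mixed with it.
    Therefore only classes of one parity are kept, and a block of them is enlarged
    by the preceding class of the other parity; then it contains two consecutive
    classes, and disjoint blocks remain disjoint. *)
Section Parity.
Variables (phi : nat -> nat) (odd_class : bool).
Hypothesis phi_mono : {homo phi : i j / i <= j}.
Hypothesis phi_split : forall p m, phi p = m.+1 ->
  exists i j, [/\ phi i = m, phi j = m.+1 & cross_split i j].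

Let Y := [set u in y | (0 < phi (pos u)) && (odd (phi (pos u)) == odd_class)].
Let e' u v := [&& e u v, phi (pos u) != phi (pos v), u \in Y & v \in Y].
Let pos' u := (phi (pos u))./2.
Let enlarge (T : {set V}) :=
  [set w in y | [exists u in T, (phi (pos u)).-1 <= phi (pos w) <= phi (pos u)]].

Lemma phi_lt i j : phi i < phi j -> i < j.
Proof. by move=> H; rewrite ltnNge; apply/negP => /phi_mono; lia. Qed.

Lemma YP u : u \in Y ->
  [/\ u \in y, 0 < phi (pos u) & odd (phi (pos u)) = odd_class].
Proof. by rewrite inE => /and3P[-> -> /eqP]. Qed.

Lemma sub_enlarge (T : {set V}) : T \subset Y -> T \subset enlarge T.
Proof.
move=> /subsetP TY; apply/subsetP => u uT; have [uy _ _] := YP (TY u uT).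
by rewrite inE uy; apply/exists_inP; exists u => //; rewrite leqnn leq_pred.
Qed.

Lemma before_enlarge (T1 T2 : {set V}) : T1 \subset Y -> T2 \subset Y ->
  before pos' T1 T2 -> before pos (enlarge T1) (enlarge T2).
Proof.
move=> /subsetP TY1 /subsetP TY2 /beforeP bT; apply/beforeP => a b.
rewrite !inE => /andP[ay /exists_inP[u uT /andP[_ au]]].
move=> /andP[bY /exists_inP[v vT /andP[bv _]]].
have [_ u0 ou] := YP (TY1 u uT); have [_ v0 ov] := YP (TY2 v vT).
have := bT u v uT vT; rewrite /pos' => uv; apply: phi_lt.
apply: leq_ltn_trans au (leq_trans _ bv); apply: half_lt_pred uv.
by rewrite ou ov.
Qed.

Lemma mixed_enlarge (T1 T2 : {set V}) : T1 \subset Y -> T2 \subset Y ->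
  before pos' T1 T2 -> mixed e' T1 T2 -> mixed e (enlarge T1) (enlarge T2).
Proof.
move=> TY1 TY2 /beforeP bT.
have E : {in T1 & T2, forall a b, e' a b = e a b /\ e' b a = e b a}.
  move=> a b aT bT2; have := bT a b aT bT2; rewrite /pos' => ab.
  rewrite /e' (subsetP TY1 a aT) (subsetP TY2 b bT2) !andbT.
  have -> : phi (pos a) != phi (pos b) by apply: contraTneq ab => ->; rewrite ltnn.
  have -> : phi (pos b) != phi (pos a) by apply: contraTneq ab => ->; rewrite ltnn.
  by rewrite !andbT.
have s1 := sub_enlarge TY1; have s2 := sub_enlarge TY2.
move=> /andP[S1 S2]; apply/andP; split.
  apply: splitsS s1 s2 _; case/splitsP: S1 => [a [b [b' [aT bT2 bT2' H]]]].
  by apply/splitsP; exists a, b, b'; rewrite -!(E a _ _ _).1.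
apply: splitsS s2 s1 _; case/splitsP: S2 => [a [b [b' [aT bT2 bT2' H]]]].
by apply/splitsP; exists a, b, b'; rewrite -!(E _ a _ _).2.
Qed.

(** Two vertices of the enlarged block are distinguished by some vertex of [A].
    The one adjacent to it is not complete to [A], and so splits [A]. *)
Lemma mixed_outside (T : {set V}) : T \subset Y -> T != set0 ->
  mixed e A (enlarge T).
Proof.
move=> /subsetP TY /set0Pn[u uT]; have [uy u0 _] := YP (TY u uT).
have [i [j [ei ej /cross_splitP[x [a [b [xA ay bY]]]]]]] :=
  phi_split (esym (prednK u0)).
move=> /and3P[/andP[ia aj] /andP[ib bj] xab].
have inT c : c \in y -> i <= pos c -> pos c <= j -> c \in enlarge T.
  move=> cy /phi_mono ic /phi_mono cj; rewrite inE cy.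
  apply/exists_inP; exists u => //; apply/andP; split; first by rewrite -ei.
  by apply: leq_trans cj _; rewrite ej prednK.
apply/andP; split; apply/splitsP.
  by exists x, a, b; split=> //; apply: inT.
have [ea|nea] := boolP (e x a).
  have [w wA nw] := noncomplete ay.
  by exists a, x, w; split=> //; [exact: inT|rewrite !(e_sym a) ea (negbTE nw)].
have eb : e x b by move: xab; rewrite (negbTE nea); case: (e x b).
have [w wA nw] := noncomplete bY.
by exists b, x, w; split=> //; [exact: inT|rewrite !(e_sym b) eb (negbTE nw)].
Qed.

Lemma minor_free_class : minor_free e' pos' D Y.
Proof.
move=> s /andP[s0 sp] sY.
have yE (T : {set V}) : enlarge T \subset y by apply/subsetP => w; rewrite inE => /andP[].
have nonempty (T : {set V}) : T \in s -> T != set0.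
  by apply: contraTneq => ->.
have E0 (T : {set V}) : T \in s -> enlarge T != set0.
  move=> Ts; have /set0Pn[u uT] := nonempty T Ts.
  by apply/set0Pn; exists u; apply: (subsetP (sub_enlarge (allP sY T Ts))).
case: s => [|T0 s'] // in s0 sp sY nonempty E0 *.
rewrite -ltnS -(size_map enlarge (T0 :: s')).
apply: (free (s := A :: map enlarge (T0 :: s'))); last first.
  rewrite /= AS (subset_trans (yE _) yS); apply/allP => _ /mapP[T _ ->].
  exact: subset_trans (yE _) yS.
set s := T0 :: s' in sp sY nonempty E0 *.
apply/andP; split; last rewrite pairwise_cons; last (apply/andP; split).
- rewrite in_cons negb_or; apply/andP; split; last first.
    by apply/mapP => -[T Ts]; apply/eqP; rewrite eq_sym; apply: E0.
  have T0s : T0 \in s by rewrite mem_head.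
  have /andP[/splitsP[a [_ [_ [aA _ _ _]]]] _] :=
    mixed_outside (allP sY T0 T0s) (nonempty T0 T0s).
  by rewrite eq_sym; apply/set0Pn; exists a.
- apply/allP => _ /mapP[T Ts ->]; rewrite mixed_outside ?(allP sY) ?nonempty //.
  rewrite andbT; apply/beforeP => a b aA bT.
  by apply: (beforeP _ _ _ Ay) => //; apply: subsetP bT.
- rewrite pairwise_map; apply: (sub_in_pairwise _ sY sp).
  move=> T1 T2 TY1 TY2 /= /andP[bT mT].
  by rewrite before_enlarge // mixed_enlarge.
Qed.

Lemma class_colorable : colorable_in e' Y k.
Proof.
apply: colorD minor_free_class.
- by move=> u v; rewrite /e' e_sym eq_sym (andbC (u \in Y)).
- move=> u v /and4P[_ uv uY vY]; apply: contraNneq uv => E.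
  have [_ u0 ou] := YP uY; have [_ v0 ov] := YP vY.
  rewrite -[phi (pos u)]odd_double_half -[phi (pos v)]odd_double_half.
  by rewrite ou ov -/(pos' u) -/(pos' v) E.
- apply: leq_ltn_trans omy; apply: omega_sub => [u v _ _ /and4P[]//|].
  by apply/subsetP => u /YP[].
Qed.
End Parity.

(** The odd classes and the even classes other than the first one get a palette of
    size [k] each, and the first class gets one more color. *)
Lemma cross_coloring : exists c : V -> nat,
  {in y, forall u, c u < 2 * k + 1} /\
  {in y &, forall u v, e u v -> pos u < pos v -> cross_split (pos u) (pos v) ->
     c u <> c v}.
Proof.
have [|phi [mono lt_phi split_phi]] := @greedy_classes cross_split.
  move=> i' i j j' ii jj /cross_splitP[x [a [b [xA ay bY]]]].
  move=> /and3P[/andP[ia aj] /andP[ib bj] H].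
  apply/cross_splitP; exists x, a, b; split=> //; apply/and3P; split=> //;
  by apply/andP; split; [apply: leq_trans ii _|apply: leq_trans jj].
have [f [fk fp]] := class_colorable false mono split_phi.
have [g [gk gp]] := class_colorable true mono split_phi.
pose ph u := phi (pos u).
have inY b u : u \in y -> 0 < ph u -> odd (ph u) = b ->
  u \in [set u in y | (0 < phi (pos u)) && (odd (phi (pos u)) == b)].
  by rewrite inE => -> -> ->; rewrite eqxx.
exists (fun u => if ph u == 0 then 2 * k else if odd (ph u) then g u else k + f u).
split=> [u uy|u v uy vy uv puv suv].
  case: ifPn => [_|]; first by lia.
  rewrite -lt0n => u0; case: ifPn => ou.
    by have := gk u (inY true u uy u0 ou); lia.
  by have := fk u (inY false u uy u0 (negbTE ou)); lia.
have := lt_phi _ _ puv suv; rewrite -/(ph u) -/(ph v) => phuv.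
have neq : ph u != ph v by rewrite neq_ltn phuv.
have v0 : 0 < ph v by lia.
have -> : (ph v == 0) = false by lia.
case: ifPn => [_|].
  case: ifPn => ov; first by have := gk v (inY true v vy v0 ov); lia.
  by have := fk v (inY false v vy v0 (negbTE ov)); lia.
rewrite -lt0n => u0; case: ifPn => ou; case: ifPn => ov.
- have iu := inY true u uy u0 ou; have iv := inY true v vy v0 ov.
  by apply: gp => //; rewrite uv iu iv neq.
- by have := gk u (inY true u uy u0 ou); lia.
- by have := gk v (inY true v vy v0 ov); lia.
- have iu := inY false u uy u0 (negbTE ou); have iv := inY false v vy v0 (negbTE ov).
  by move=> /addnI; apply: fp => //; rewrite uv iu iv neq.
Qed.
End Cross.

(** * Reduction to the middle part and its decomposition *)

(** Reversal of the order, which turns statements about prefixes into statements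
    about suffixes. *)
Definition mirror (V : finType) (pos : V -> nat) u := \max_v pos v - pos u.

Lemma mirror_lt (V : finType) (pos : V -> nat) u v :
  (mirror pos u < mirror pos v) = (pos v < pos u).
Proof.
rewrite /mirror; have := @leq_bigmax _ pos u; have := @leq_bigmax _ pos v; lia.
Qed.

Lemma mirror_le (V : finType) (pos : V -> nat) u v :
  (mirror pos u <= mirror pos v) = (pos v <= pos u).
Proof. by rewrite leqNgt mirror_lt -leqNgt. Qed.

Lemma before_mirror (V : finType) (pos : V -> nat) (A B : {set V}) :
  before (mirror pos) A B = before pos B A.
Proof.
apply/beforeP/beforeP => H a b aA bB; first by rewrite -mirror_lt H.
by rewrite mirror_lt H.
Qed.

Lemma proper_pos_mirror (V : finType) (e : rel V) (pos : V -> nat) :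
  proper_pos e pos -> proper_pos e (mirror pos).
Proof.
move=> H u v /H uv; rewrite neq_ltn !mirror_lt orbC -neq_ltn.
by [].
Qed.

Lemma pairwise_rev (T : Type) (r : rel T) (s : seq T) :
  pairwise r (rev s) = pairwise (fun x y => r y x) s.
Proof. by elim: s => //= x s IH; rewrite rev_cons pairwise_rcons all_rev IH. Qed.

Lemma minor_free_mirror (V : finType) (e : rel V) (pos : V -> nat) D (S : {set V}) :
  minor_free e pos D S -> minor_free e (mirror pos) D S.
Proof.
move=> H s /andP[s0 sp] sS; rewrite -size_rev; apply: H; last by rewrite all_rev.
rewrite /mixed_minor mem_rev s0 pairwise_rev; apply: sub_pairwise sp => X Y /=.
by rewrite before_mirror /mixed => /andP[-> /andP[-> ->]].
Qed.

Lemma omega0 (V : finType) (e : rel V) : omega e set0 = 0.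
Proof.
apply/eqP; rewrite -leqn0; apply/omega_leP => K _.
by rewrite subset0 => /eqP->; rewrite cards0.
Qed.

(** [L] is the shortest prefix of clique number at least [2 ^ n] (empty if there is
    none).  Without its last position it is small; its last position is
    independent; and the later vertices complete to [L] form a small set since
    their clique number and that of [L] add up to less than [2 ^ n.+1]. *)
Lemma peel_prefix (V : finType) (e : rel V) (pos : V -> nat) n h (S : {set V}) :
  symmetric e -> proper_pos e pos -> omega e S < 2 ^ n.+1 ->
  (forall S' : {set V}, S' \subset S -> omega e S' < 2 ^ n -> colorable_in e S' h) ->
  exists L S' : {set V}, [/\ L \subset S, S' \subset S, before pos L S',
    {in S', forall u, exists2 w, w \in L & ~~ e w u} &
    forall k, colorable_in e S' k -> colorable_in e S (2 * h + 1 + k)].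
Proof.
move=> e_sym e_pos omS colh; have e_irr := proper_pos_irr e_pos.
have [small|big] := ltnP (omega e S) (2 ^ n).
  exists set0, set0; split; rewrite ?sub0set //.
  - by apply/beforeP => a b; rewrite inE.
  - by move=> u; rewrite inE.
  - by move=> k _; apply: colorable_le (colh S _ small) => //; lia.
pose below a := [set u in S | pos u <= a].
have ex : exists a, 2 ^ n <= omega e (below a).
  exists (\max_v pos v); suff -> : below (\max_v pos v) = S by [].
  by apply/setP => u; rewrite inE leq_bigmax andbT.
case: (ex_minnP ex) => a bigL mina.
pose L := below a; pose P := [set u in S | pos u < a].
pose Q := [set u in S | pos u == a].
pose C := [set u in S | (a < pos u) && [forall w in L, e w u]].
pose S' := [set u in S | (a < pos u) && ~~ [forall w in L, e w u]].
have sub p : [set u in S | p u] \subset S by apply/subsetP => u; rewrite inE => /andP[].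
have colP : colorable_in e P h.
  apply: colh; first exact: sub.
  rewrite ltnNge; apply/negP => bigP.
  case: a => [|a] in mina P bigP {bigL L Q C S'}.
    have P0 : P = set0 by apply/setP => u; rewrite !inE ltn0 andbF.
    by move: bigP; rewrite P0 omega0; have := expn_gt0 2 n; lia.
  have eP : P = below a by apply/setP => u; rewrite !inE ltnS.
  by have := mina a; rewrite -eP bigP ltnn => /(_ isT).
have colQ : colorable_in e Q 1.
  apply: colorable_independent => u v; rewrite !inE => /andP[_ /eqP pu] /andP[_ /eqP pv].
  by apply/negP => /e_pos; rewrite pu pv eqxx.
have colC : colorable_in e C h.
  apply: colh; first exact: sub.
  suff : omega e L + omega e C <= omega e S.
    by move: bigL omS; rewrite -/L expnS; lia.
  apply: omega_join; rewrite ?sub // => w u wL; rewrite inE => /and3P[_ _ /forall_inP]; exact.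
exists L, S'; split; rewrite ?sub //.
- by apply/beforeP => w u; rewrite !inE => /andP[_ wa] /and3P[_ au _]; lia.
- by move=> u; rewrite inE => /and3P[_ _]; rewrite negb_forall_in => /exists_inP.
- move=> k colS'.
  have -> : 2 * h + 1 + k = h + (1 + (h + k)) by lia.
  apply: (@colorableU _ _ _ P (Q :|: (C :|: S'))) => //.
    apply/subsetP => u uS; rewrite !inE uS /=.
    by case: ltngtP => //= _; rewrite orbN.
  apply: (@colorableU _ _ _ Q (C :|: S')) => //.
  exact: (@colorableU _ _ _ C S').
Qed.

Definition between i j m := (i <= m <= j) || (j <= m <= i).

Lemma betweenC i j m : between i j m = between j i m.
Proof. by rewrite /between orbC. Qed.

Lemma betweenl i j : between i j i.
Proof. rewrite /between; lia. Qed.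

Lemma betweenr i j : between i j j.
Proof. rewrite /between; lia. Qed.

Lemma between_refl i j m : between i i m -> between i j m.
Proof. rewrite /between; lia. Qed.

Lemma between_split i j l m : between i l m -> between i j m || between j l m.
Proof. rewrite /between; lia. Qed.

Lemma between_widen i a v b m : a <= v <= b -> between i v m ->
  between i (if i <= v then b else a) m.
Proof. rewrite /between; case: ifP; lia. Qed.

Lemma between_lt i j m : i < j -> between i j m -> i <= m <= j.
Proof. rewrite /between; lia. Qed.

Lemma odd_square_gt1 k : 0 < k -> 1 < (2 * k + 1) * (2 * k + 1).
Proof. by move=> k0; apply: (@ltn_mul 1 1); lia. Qed.

(** [L], [W], [R] follow each other in the order and exhaust [T]; the decomposition
    of [W] is made with respect to all of [T]. *)
Section Mid.
Variables (V : finType) (e : rel V) (pos : V -> nat) (D n k h : nat).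
Variables (L W R T : {set V}).
Hypothesis D0 : 0 < D.
Hypothesis n0 : 0 < n.
Hypothesis k0 : 0 < k.
Hypothesis e_sym : symmetric e.
Hypothesis e_pos : proper_pos e pos.
Hypothesis colorD : forall (e' : rel V) (pos' : V -> nat) (S' : {set V}),
  symmetric e' -> proper_pos e' pos' -> omega e' S' < 2 ^ n.+1 ->
  minor_free e' pos' D S' -> colorable_in e' S' k.
Hypothesis free : minor_free e pos D.+1 T.
Hypothesis LT : L \subset T.
Hypothesis WT : W \subset T.
Hypothesis RT : R \subset T.
Hypothesis TU : T \subset L :|: W :|: R.
Hypothesis LW : before pos L W.
Hypothesis WR : before pos W R.
Hypothesis noncompleteL : {in W, forall u, exists2 w, w \in L & ~~ e w u}.
Hypothesis noncompleteR : {in W, forall u, exists2 w, w \in R & ~~ e w u}.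
Hypothesis omW : omega e W < 2 ^ n.+1.
Hypothesis small_color : forall S' : {set V},
  S' \subset W -> omega e S' < 2 ^ n -> colorable_in e S' h.

Let big y := 2 ^ n <= omega e y.

Definition convex_in (y : {set V}) := y \subset W /\
  forall u w v, u \in y -> w \in y -> v \in W -> pos u <= pos v <= pos w -> v \in y.

Definition hull u w a := between (pos u) (pos w) (pos a).

Definition linked (y : {set V}) u w := [forall x in T :\: y,
  forall a in y, forall b in y, hull u w a && hull u w b ==> (e x a == e x b)].

Definition homogeneous (y : {set V}) :=
  [forall x in T :\: y, forall a in y, forall b in y, e x a == e x b].

Definition first (y : {set V}) w := [forall a in y, pos w <= pos a].

(** If nothing outside distinguishes vertices of [y], the classes of [linked]
    do not decompose [y]; then [y] is split into its first position and the rest.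
    A position on which some outside vertex is not constant is decomposed into
    single vertices, through the alternative [w == u]. *)
Definition child (y : {set V}) u :=
  if homogeneous y then [set w in y | first y w == first y u]
  else [set w in y | (w == u) || linked y u w].

Lemma linkedP (y : {set V}) u w :
  reflect (forall x a b, x \in T :\: y -> a \in y -> b \in y ->
             hull u w a -> hull u w b -> e x a = e x b) (linked y u w).
Proof.
apply: (iffP forall_inP) => [H x a b xT ay bY ha hb|H x xT].
  have /forall_inP/(_ a ay)/forall_inP/(_ b bY) := H x xT.
  by rewrite ha hb => /eqP.
apply/forall_inP => a ay; apply/forall_inP => b bY; apply/implyP => /andP[ha hb].
by apply/eqP; apply: H.
Qed.

Lemma homogeneousP (y : {set V}) :
  reflect (forall x a b, x \in T :\: y -> a \in y -> b \in y -> e x a = e x b)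
          (homogeneous y).
Proof.
apply: (iffP forall_inP) => [H x a b xT ay bY|H x xT].
  by have /forall_inP/(_ a ay)/forall_inP/(_ b bY)/eqP := H x xT.
apply/forall_inP => a ay; apply/forall_inP => b bY; apply/eqP; exact: H.
Qed.

Lemma linked_sym (y : {set V}) u w : linked y u w = linked y w u.
Proof.
by apply/linkedP/linkedP => H x a b xT ay bY ha hb; apply: H => //;
  rewrite /hull betweenC.
Qed.

Lemma linkedS (y : {set V}) u w u' w' :
  {in y, forall a, hull u' w' a -> hull u w a} -> linked y u w -> linked y u' w'.
Proof.
move=> H /linkedP lk; apply/linkedP => x a b xT ay bY ha hb.
by apply: lk => //; apply: H.
Qed.

Lemma linked_trans (y : {set V}) u v w :
  v \in y -> linked y u v -> linked y v w -> linked y u w.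
Proof.
move=> vy /linkedP uv /linkedP vw; apply/linkedP => x a b xT ay bY ha hb.
have eqv c : c \in y -> hull u w c -> e x c = e x v.
  move=> cy /(between_split (pos v))/orP[huv|hvw].
    by apply: uv => //; apply: betweenr.
  by apply: vw => //; apply: betweenl.
by rewrite (eqv a) // (eqv b).
Qed.

Lemma linked_eq (y : {set V}) u w x : u \in y -> w \in y -> linked y u w ->
  x \in T :\: y -> e x u = e x w.
Proof.
by move=> uy wy /linkedP H xT; apply: H => //; [exact: betweenl|exact: betweenr].
Qed.

Lemma child_sub (y : {set V}) u : child y u \subset y.
Proof. by rewrite /child; case: ifP => _; apply/subsetP => w; rewrite inE => /andP[]. Qed.

Lemma child_mem (y : {set V}) u : u \in y -> u \in child y u.
Proof. by rewrite /child => uy; case: ifP => _; rewrite inE uy eqxx. Qed.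

Lemma child_eq (y : {set V}) u v :
  u \in y -> v \in child y u -> child y v = child y u.
Proof.
move=> uy; rewrite /child; case: ifP => _; rewrite inE => /andP[vy].
  by move=> /eqP->.
case/orP => [/eqP-> //|uv]; apply/setP => w; rewrite !inE.
have [wy|//] := boolP (w \in y); apply/orP/orP => -[/eqP->|lw]; right => //.
- exact: linked_trans vy uv lw.
- by rewrite linked_sym.
- by apply: linked_trans uy _ lw; rewrite linked_sym.
Qed.

Lemma child_agree (y : {set V}) u x : u \in y -> x \in T :\: y ->
  uniform_on e (child y u) x.
Proof.
move=> uy xT; rewrite /child; case: ifP => [/homogeneousP H|_] a b; rewrite !inE.
  by move=> /andP[ay _] /andP[bY _]; apply: H.
have eu c : c \in y -> (c == u) || linked y u c -> e x c = e x u.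
  by move=> cy /orP[/eqP->//|lk]; rewrite (linked_eq uy cy lk).
by move=> /andP[ay la] /andP[bY lb]; rewrite (eu a) // (eu b).
Qed.

Lemma big_edge (y : {set V}) : big y ->
  exists u v, [/\ u \in y, v \in y, e u v & pos u < pos v].
Proof.
move=> bY; have : 1 < omega e y.
  by apply: leq_trans bY; rewrite -{1}(expn0 2) ltn_exp2l.
case/omega_gt1P => u [v [uy vy uv]].
have := e_pos uv; rewrite neq_ltn => /orP[p|p]; first by exists u, v.
by exists v, u; split=> //; rewrite e_sym.
Qed.

Lemma firstP (y : {set V}) w :
  reflect {in y, forall a, pos w <= pos a} (first y w).
Proof. exact: forall_inP. Qed.

Lemma child_proper (y : {set V}) u : big y -> u \in y -> child y u \proper y.
Proof.
move=> bY uy; rewrite properEneq child_sub andbT; apply/eqP => E.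
move: E; rewrite /child; case: ifPn => [_ /setP E|/negP nh /setP E].
  have [a [b [ay bY' _ ab]]] := big_edge bY.
  case: (@arg_minnP _ a (fun z => z \in y) pos ay) => m my minm.
  have fm : first y m by apply/firstP.
  have nb : ~~ first y b by apply/firstP => /(_ a ay); rewrite leqNgt ab.
  have := E m; have := E b; rewrite !inE my bY' fm (negbTE nb) /=.
  by case: (first y u).
apply: nh; apply/homogeneousP => x a b xT ay bY'.
have eu c : c \in y -> e x c = e x u.
  move=> cy; have := E c; rewrite inE cy /= => /orP[/eqP->//|lk].
  by rewrite (linked_eq uy cy lk).
by rewrite (eu a) // (eu b).
Qed.

(** Bigness excludes the single vertices split off from a position, which need
    not be convex. *)
Lemma child_convex (y : {set V}) u : convex_in y -> u \in y -> big (child y u) ->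
  convex_in (child y u).
Proof.
move=> [yW cy] uy bc; split; first exact: subset_trans (child_sub y u) yW.
move=> a b v; have [p [q [pc qc _ pq]]] := big_edge bc.
move: pc qc; rewrite /child; case: ifP => _; rewrite !inE.
  move=> _ _ /andP[ay /eqP <-] /andP[bY /eqP fb] vW /andP[av vb].
  have vy : v \in y by apply: (cy a b) => //; rewrite av.
  rewrite vy /=; apply/eqP; apply/firstP/idP => [H|fa c cc].
    by apply/firstP => c cc; apply: leq_trans av (H c cc).
  by apply: leq_trans vb _; move: c cc; apply/firstP; rewrite fb.
move=> /andP[py lp] /andP[qy lq].
have luu : linked y u u.
  have [/eqP ep|lpu] := orP lp; last first.
    by apply: linkedS lpu => c _; apply: between_refl.
  have [/eqP eq|lqu] := orP lq; first by move: pq; rewrite ep eq ltnn.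
  by apply: linkedS lqu => c _; apply: between_refl.
have lall c : (c == u) || linked y u c -> linked y u c by case/orP => [/eqP->|].
move=> /andP[ay /lall la] /andP[bY /lall lb] vW avb.
rewrite (cy a b v) //=; apply/orP; right.
have [uv|vu] := leqP (pos u) (pos v).
  by apply: linkedS lb => c _ /(between_widen avb); rewrite uv.
by apply: linkedS la => c _ /(between_widen avb); rewrite leqNgt vu.
Qed.

Let q := (2 * k + 1) * (2 * k + 1).

Lemma palette_gt1 : 1 < q.
Proof. exact: odd_square_gt1. Qed.

(** If [u] and [v] are not linked, two vertices between them are distinguished by a
    vertex on the left or on the right of [y], and [cross_coloring] applies on that
    side; the color is the pair of the colors for both sides. *)
Lemma child_coloring (y : {set V}) : exists c : V -> nat,
  convex_in y -> big y ->
  {in y, forall u, c u < q} /\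
  {in y &, forall u v, e u v -> child y u != child y v -> c u <> c v}.
Proof.
have [hy|nh] := boolP (homogeneous y).
  exists (fun u => nat_of_bool (first y u)) => _ _; split=> [u _|u v uy vy uv].
    apply: leq_ltn_trans (leq_b1 _) _; exact: palette_gt1.
  rewrite /child hy => nc E; case/eqP: nc; apply/setP => w; rewrite !inE.
  by case: (first y u) E; case: (first y v).
pose AL := [set x in T :\: y | [forall a in y, pos x < pos a]].
pose AR := [set x in T :\: y | [forall a in y, pos a < pos x]].
suff [c H] : exists c : V -> nat, convex_in y -> {in y, forall u, c u < q} /\
  {in y &, forall u v, e u v -> pos u < pos v -> ~~ linked y u v -> c u <> c v}.
  exists c => cy _; have [c1 c2] := H cy; split=> // u v uy vy uv nc.
  have nl : ~~ linked y u v.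
    apply: contra nc => lk; rewrite eq_sym; apply/eqP/child_eq => //.
    by rewrite /child (negbTE nh) inE vy lk orbT.
  have := e_pos uv; rewrite neq_ltn => /orP[p|p]; first exact: c2.
  by move/esym; apply: c2 => //; rewrite ?[e v u]e_sym // linked_sym.
suff H : convex_in y -> exists c : V -> nat, {in y, forall u, c u < q} /\
  {in y &, forall u v, e u v -> pos u < pos v -> ~~ linked y u v -> c u <> c v}.
  have [uy|/negP] := boolP ((y \subset W) && [forall u in y, forall w in y,
    forall v in W, (pos u <= pos v <= pos w) ==> (v \in y)]).
    have [|c Hc] := H; last by exists c.
    case/andP: uy => yW /forall_inP cy; split=> // u w v uy wy vW p.
    by have /forall_inP/(_ w wy)/forall_inP/(_ v vW)/implyP/(_ p) := cy u uy.
  move=> nc; exists (fun=> 0) => -[yW cy]; case: nc; rewrite yW.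
  apply/forall_inP => u uy; apply/forall_inP => w wy; apply/forall_inP => v vW.
  by apply/implyP => p; apply: (cy u w).
move=> [yW cy].
have yT := subset_trans yW WT.
have omy : omega e y < 2 ^ n.+1 by apply: leq_ltn_trans omW; apply: omegaS.
have AT p : [set x in T :\: y | p x] \subset T.
  by apply/subsetP => x; rewrite !inE => /andP[/andP[]].
have LAL w : w \in L -> w \in T :\: y.
  move=> wL; rewrite inE (subsetP LT) // andbT; apply/negP => wy.
  by have := beforeP _ _ _ LW w w wL (subsetP yW w wy); rewrite ltnn.
have RAR w : w \in R -> w \in T :\: y.
  move=> wR; rewrite inE (subsetP RT) // andbT; apply/negP => wy.
  by have := beforeP _ _ _ WR w w (subsetP yW w wy) wR; rewrite ltnn.
have [cL [cL1 cL2]] : exists c : V -> nat, {in y, forall u, c u < 2 * k + 1} /\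
  {in y &, forall u v, e u v -> pos u < pos v ->
     cross_split e pos AL y (pos u) (pos v) -> c u <> c v}.
  apply: (cross_coloring D0 e_sym colorD free (AT _) yT _ _ omy).
    by apply/beforeP => x a; rewrite inE => /andP[_ /forall_inP H] /H.
  move=> u uy; have [w wL nw] := noncompleteL (subsetP yW u uy).
  exists w => //; rewrite inE LAL //; apply/forall_inP => a ay.
  by apply: (beforeP _ _ _ LW) => //; apply: (subsetP yW).
have [cR [cR1 cR2]] : exists c : V -> nat, {in y, forall u, c u < 2 * k + 1} /\
  {in y &, forall u v, e u v -> mirror pos u < mirror pos v ->
     cross_split e (mirror pos) AR y (mirror pos u) (mirror pos v) -> c u <> c v}.
  apply: (cross_coloring D0 e_sym colorD (minor_free_mirror free) (AT _) yT _ _ omy).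
    rewrite before_mirror; apply/beforeP => a x ay; rewrite inE => /andP[_ /forall_inP].
    exact.
  move=> u uy; have [w wR nw] := noncompleteR (subsetP yW u uy).
  exists w => //; rewrite inE RAR //; apply/forall_inP => a ay.
  by apply: (beforeP _ _ _ WR) => //; apply: (subsetP yW).
exists (fun u => cL u * (2 * k + 1) + cR u); split=> [u uy|u v uy vy uv puv nl].
  by apply: pair_code_lt; [exact: cL1|exact: cR1].
move=> /pair_code_inj[||]; [exact: cR1|exact: cR1|move=> eL eR].
case/negP: nl; apply/linkedP => x a b xT ay bY; rewrite /hull => ha hb.
apply/eqP/negPn/negP => xab.
have xLR : (x \in AL) || (x \in AR).
  rewrite !(inE, in_setD) in xT *; rewrite !xT /= -[_ || _]negbK negb_or !negb_forall_in.
  apply/negP => /andP[/exists_inP[c1 c1y p1] /exists_inP[c2 c2y p2]].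
  rewrite -leqNgt in p1; rewrite -leqNgt in p2.
  case/andP: xT => [/negP nxy /(subsetP TU)].
  rewrite !inE -orbA => /or3P[xL|xW|xR].
  - by move: p1; rewrite leqNgt (beforeP _ _ _ LW) // (subsetP yW).
  - by apply: nxy; apply: (cy c1 c2) => //; rewrite p1.
  - by move: p2; rewrite leqNgt (beforeP _ _ _ WR) // (subsetP yW).
case/orP: xLR => xA.
  apply: (cL2 u v) => //; apply/cross_splitP; exists x, a, b; split=> //.
  by rewrite /distinguishes xab !andbT !(between_lt puv).
apply: (cR2 v u) => //; rewrite ?mirror_lt // 1?e_sym //.
apply/cross_splitP; exists x, a, b; split=> //.
have /andP[ua av] := between_lt puv ha; have /andP[ub bv] := between_lt puv hb.
by rewrite /distinguishes xab !mirror_le ua av ub bv.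
Qed.

Lemma mid_coloring : colorable_in e W (2 ^ n * q * q * q * h).
Proof.
have [c Hc] := @fin_all_exists {set V} (fun=> V -> nat) _ child_coloring.
have [inner Hi] : exists inner : {set V} -> V -> nat, forall y : {set V},
  y \subset W -> ~~ big y -> {in y, forall u, inner y u < h} /\
  {in y &, forall u v, e u v -> inner y u <> inner y v}.
  apply: (@fin_all_exists {set V} (fun=> V -> nat) (fun y f => y \subset W -> ~~ big y ->
    {in y, forall u, f u < h} /\ {in y &, forall u v, e u v -> f u <> f v})) => y.
  have [yW|] := boolP (y \subset W); last by exists (fun=> 0).
  have [by_|nb] := boolP (big y); first by exists (fun=> 0).
  by have [|f Hf] := small_color yW; [rewrite ltnNge|exists f].
apply: (@tree_coloring V e W n q h child c inner convex_in) => //.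
- exact: proper_pos_irr e_pos.
- by move=> y u _ _; apply: child_mem.
- by move=> y u _; apply: child_proper.
- by move=> y u cy _; apply: child_convex.
- by move=> y u v _ _; apply: child_eq.
- move=> y u x [yW _] _ uy xW; apply: child_agree => //.
  by move: xW; rewrite !inE => /andP[-> /(subsetP WT)].
- by move=> y u cy bY uy; have [H _] := Hc y cy bY; apply: H.
- by move=> y u v cy bY uy vy; have [_ H] := Hc y cy bY; apply: H.
- exact: ltnW palette_gt1.
Qed.
End Mid.

(** * The coloring bound for graphs without mixed minors *)

Fixpoint bound_coef d := if d is d'.+1 then 6 * bound_coef d' + 13 else 0.

(** The exponent works because [n ^ d.+2 - m ^ d.+2] is at least [n ^ d.+1] for
    [n = m.+1], which absorbs the contribution of the previous [d]. *)
Lemma bound_step c d m (n := m.+1) (k := 2 ^ (c * n ^ d.+1))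
    (q := (2 * k + 1) * (2 * k + 1)) (h := 2 ^ ((6 * c + 13) * m ^ d.+2)) :
  2 * h + 1 + (2 * h + 1 + 2 ^ m * q * q * q * h) <=
  2 ^ ((6 * c + 13) * n ^ d.+2).
Proof.
pose a := c * n ^ d.+1.
have k2 : 2 * k + 1 <= 2 ^ a.+2 by have := expn_gt0 2 a; rewrite !expnS /k /a; lia.
have q2 : q <= 2 ^ (a.+2 + a.+2) by rewrite expnD leq_mul.
have r2 : 2 ^ m * q * q * q <= 2 ^ (m + (a.+2 + a.+2) + (a.+2 + a.+2) + (a.+2 + a.+2)).
  by rewrite !expnD !leq_mul // -expnD.
have h0 : 0 < h by rewrite expn_gt0.
apply: (@leq_trans (2 ^ (m + 6 * a + 13) * h)).
  have -> : m + 6 * a + 13 = (m + (a.+2 + a.+2) + (a.+2 + a.+2) + (a.+2 + a.+2)).+1 by lia.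
  have : 2 ^ m * q * q * q * h <= 2 ^ (m + (a.+2 + a.+2) + (a.+2 + a.+2) + (a.+2 + a.+2)) * h.
    by rewrite leq_mul2r r2 orbT.
  have : 6 * h <= 2 ^ (m + (a.+2 + a.+2) + (a.+2 + a.+2) + (a.+2 + a.+2)) * h.
    rewrite leq_mul2r; apply/orP; right.
    apply: (@leq_trans (2 ^ 3)) => //; rewrite leq_exp2l //; lia.
  rewrite expnS -mulnA; lia.
rewrite -expnD leq_exp2l // [n ^ d.+2]expnS.
have nd : n <= n ^ d.+1 by rewrite expnS leq_pmulr // expn_gt0.
have md : m ^ d.+2 <= m * n ^ d.+1 by rewrite expnS leq_mul2l leq_exp2r ?leqnSn ?orbT.
rewrite /a; move: (n ^ d.+1) (m ^ d.+2) nd md => x y nd md.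
have H1 : (6 * c + 13) * y <= (6 * c + 13) * (m * x) by rewrite leq_mul2l md orbT.
have H2 : (6 * c + 13) * (n * x) = (6 * c + 13) * (m * x) + 6 * (c * x) + 13 * x.
  by rewrite /n mulSn; lia.
rewrite H2; move: H1; rewrite /n in nd *; lia.
Qed.

(** For [d = 0] there is no vertex at all, since a single vertex is a family of one
    block.  Otherwise a prefix is peeled off, then a suffix as a prefix for the
    mirrored order, and the middle part is decomposed, with the two induction
    hypotheses providing the colors of the small sets and of the cross edges. *)
Lemma coloring_bound d n (V : finType) (e : rel V) (pos : V -> nat) (S : {set V}) :
  symmetric e -> proper_pos e pos -> omega e S < 2 ^ n ->
  minor_free e pos d.+1 S -> colorable_in e S (2 ^ (bound_coef d * n ^ d.+1)).
Proof.
elim: d n e pos S => [|d IHd] n e pos S.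
  move=> _ _ _ free; exists (fun=> 0); split=> // u v uS.
  have := free [:: [set u]]; rewrite /mixed_minor inE /= sub1set uS eq_sym.
  by rewrite -card_gt0 cards1 => /(_ isT isT).
elim: n e pos S => [|m IHn] e pos S e_sym e_pos omS free.
  exists (fun=> 0); split=> [u _|u v uS]; first by rewrite expn_gt0.
  by have := omega_gt0 e uS; rewrite lt0n; move: omS; rewrite expn0 ltnS leqn0 => ->.
have [m0|m0] := posnP m.
  suff c1 : colorable_in e S 1 by apply: colorable_le c1; rewrite ?expn_gt0.
  apply: colorable_independent => u v uS vS; apply/negP => uv.
  have := omega_gt1 e_sym (proper_pos_irr e_pos) uS vS uv.
  by rewrite ltnNge -ltnS (leq_trans omS) // m0.
pose h := 2 ^ (bound_coef d.+1 * m ^ d.+2); pose k := 2 ^ (bound_coef d * m.+1 ^ d.+1).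
have colh (S' : {set V}) : S' \subset S -> omega e S' < 2 ^ m -> colorable_in e S' h.
  by move=> S'S om; apply: (IHn e pos) => //; apply: minor_freeS free.
have [L [S1 [LS S1S LS1 ncL colS]]] := peel_prefix e_sym e_pos omS colh.
have omS1 : omega e S1 < 2 ^ m.+1 by apply: leq_ltn_trans omS; apply: omegaS.
have [|R [W [RS WS RW ncR colS1]]] :=
  peel_prefix e_sym (proper_pos_mirror e_pos) omS1 (h := h).
  by move=> S' S'S; apply: colh; apply: subset_trans S1S.
apply: colorable_le (subxx S) (bound_step _ _ _) _; apply: colS; apply: colS1.
have WS' := subset_trans WS S1S; have RS' := subset_trans RS S1S.
apply: (@mid_coloring V e pos d.+1 m k h L W R (L :|: W :|: R)) => //.
- by rewrite expn_gt0.
- by move=> e' pos' S'; apply: IHd.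
- by apply: minor_freeS free; rewrite !subUset LS WS' RS'.
- by rewrite -setUA subsetUl.
- by apply/subsetP => x; rewrite !inE => ->; rewrite orbT.
- by rewrite subsetUr.
- by apply/beforeP => a b aL bW; apply: (beforeP _ _ _ LS1) => //; apply: (subsetP WS).
- by rewrite -before_mirror.
- by move=> u uW; apply: ncL; apply: (subsetP WS).
- by apply: leq_ltn_trans omS; apply: omegaS.
- by move=> S' S'W; apply: colh; apply: subset_trans WS'.
Qed.

(** * Bounded twin-width excludes mixed minors *)

Lemma path_crossing (T : eqType) (r : rel T) (p : pred T) x s :
  path r x s -> ~~ p x -> p (last x s) ->
  exists y z, [/\ y \in x :: s, z \in x :: s, r y z, ~~ p y & p z].
Proof.
elim: s x => [|z s IH] x /=; first by move=> _ /negbTE->.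
move=> /andP[xz zs] px plast; have [pz|npz] := boolP (p z).
  by exists x, z; split; rewrite // !inE eqxx ?orbT.
have [y [w [ys ws yw py pw]]] := IH z zs npz plast.
by exists y, w; split; rewrite // in_cons ?ys ?ws orbT.
Qed.

Lemma contracts_toP (G : graph) (P Q : {set {set G}}) :
  reflect (exists A B, [/\ A \in P, B \in P, A != B & Q = contract P A B])
          (contracts_to P Q).
Proof.
apply: (iffP exists_inP) => [[A AP /exists_inP[B BP /andP[AB /eqP E]]]|].
  by exists A, B.
move=> [A [B [AP BP AB ->]]]; exists A => //; apply/exists_inP.
by exists B; rewrite // AB eqxx.
Qed.

Lemma mem_contract (G : graph) (P : {set {set G}}) A B Z :
  Z \in contract P A B -> Z = A :|: B \/ Z \in P.
Proof.
by rewrite !inE => /orP[/eqP->|/andP[_ ->]]; [left|right].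
Qed.

Definition convex_for (G : graph) (pos : G -> nat) (Z : {set G}) :=
  forall u w v, u \in Z -> w \in Z -> pos u <= pos v <= pos w -> v \in Z.

Lemma double_bit_le a b (x y : bool) : a * 2 + x <= b * 2 + y -> a <= b.
Proof. by case: x; case: y => /=; lia. Qed.

Lemma double_bit_eq a b (x y : bool) :
  (a * 2 + x == b * 2 + y) = (a == b) && (x == y).
Proof. by case: x; case: y => /=; lia. Qed.

(** Built from the last partition backwards: when a part is split into [A] and [B],
    the positions are doubled and [B] is shifted by one, so that [A] and [B] become
    consecutive and the coarser parts remain intervals. *)
Lemma contraction_order (G : graph) (P : {set {set G}}) s :
  all (fun P => partition P [set: G]) (P :: s) -> path (@contracts_to G) P s ->
  last P s = [set [set: G]] ->
  exists pos : G -> nat,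
    (forall u v, (pos u == pos v) = (v \in pblock P u)) /\
    (forall Q Z, Q \in P :: s -> Z \in Q -> convex_for pos Z).
Proof.
elim: s P => [|Q s IH] P.
  move=> _ _ /= ->; exists (fun=> 0); split=> [u v|Q' Z].
    rewrite eqxx (@def_pblock _ _ setT) ?inE //.
    by apply/trivIsetP => A B; rewrite !inE => /eqP-> /eqP->; rewrite eqxx.
  by rewrite inE => /eqP->; rewrite inE => /eqP-> u w v; rewrite inE.
rewrite [all _ _]/= [path _ _ _]/= [last _ _]/= => /andP[pP pQs] /andP[PQ pth] lst.
have [pos [posE cvx]] := IH Q pQs pth lst.
have /contracts_toP[A [B [AP BP AB eQ]]] := PQ.
have /andP[pQ _] := pQs.
have /and3P[/eqP covP tP P0] := pP; have /and3P[/eqP covQ tQ Q0] := pQ.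
have inB u : (u \in B) = (pblock P u == B).
  apply/idP/eqP => [uB|<-]; first exact: def_pblock tP BP uB.
  by rewrite mem_pblock covP inE.
have ABQ : A :|: B \in Q by rewrite eQ setU11.
pose pos' u := pos u * 2 + (u \in B).
have le_pos u v : pos' u <= pos' v -> pos u <= pos v.
  exact: double_bit_le.
exists pos'.
have pos'E u v : (pos' u == pos' v) = (v \in pblock P u).
  have -> : (pos' u == pos' v) = (pos u == pos v) && ((u \in B) == (v \in B)).
    exact: double_bit_eq.
  rewrite posE; set X := pblock P u.
  have uX : u \in X by rewrite mem_pblock covP inE.
  have XP : X \in P by apply: pblock_mem; rewrite covP inE.
  have eqX w : (w \in X) = (pblock P w == X).
    apply/idP/eqP => [wX|<-]; first exact: def_pblock tP XP wX.
    by rewrite mem_pblock covP inE.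
  have [XAB|XnAB] := boolP (X \in [set A; B]).
    have uAB : u \in A :|: B.
      by move: XAB; rewrite !inE => /orP[]/eqP <-; rewrite uX ?orbT.
    rewrite (def_pblock tQ ABQ uAB); move: XAB; rewrite !inE => /orP[]/eqP EX.
      have nuB : u \notin B by rewrite inB -/X EX.
      have nvB : v \in X -> v \notin B by rewrite eqX inB => /eqP->; rewrite EX.
      by rewrite (negbTE nuB) ?inE -EX; case: (v \in X) nvB => [/(_ isT)|_];
        case: (v \in B).
    by rewrite ?inE -EX uX; case: (v \in X); rewrite ?orbT ?andbF.
  have XQ : X \in Q by rewrite eQ in_setU1 in_setD XnAB XP orbT.
  have XB : X != B by apply: contraNneq XnAB => ->; rewrite !inE eqxx orbT.
  have nuB : u \notin B by rewrite inB.
  have nvB : v \in X -> v \notin B by rewrite eqX inB => /eqP->.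
  rewrite (def_pblock tQ XQ uX) (negbTE nuB).
  by case: (v \in X) nvB => // /(_ isT)/negbTE->.
split=> // Q' Z; rewrite in_cons => /orP[/eqP->|Q's] ZQ' u w v uZ wZ /andP[uv vw].
  have eZ : pblock P u = Z by apply: def_pblock tP ZQ' uZ.
  have : pos' u == pos' w by rewrite pos'E eZ.
  move=> /eqP E; have : pos' u == pos' v by rewrite eqn_leq uv E vw.
  by rewrite pos'E eZ.
by apply: (cvx Q' Z Q's ZQ' u w v uZ wZ); rewrite !le_pos.
Qed.

(** The tuple of a contraction sequence is presented as its first partition and
    a path, in the form needed by inductions. *)
Lemma twin_width_sequence (G : graph) t : twin_width G <= t ->
  exists s : seq {set {set G}},
  [/\ all (fun P => partition P [set: G]) (singletons G :: s),
      path (@contracts_to G) (singletons G) s,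
      last (singletons G) s = [set [set: G]] &
      forall P A, P \in singletons G :: s -> A \in P -> impure_degree P A <= t].
Proof.
rewrite /twin_width; case: ex_minnP => w /existsP[s /andP[]].
case: s => [[|P s] sz] /=.
  by exfalso; have := vertex_gt0 G; rewrite -(eqP sz).
move=> /and4P[/= alls /eqP hd /eqP lst pth] /eqP ws _ wt; rewrite hd in alls lst pth ws.
exists s; split=> // P' A Ps AP; apply: leq_trans wt.
by apply: (width_leP _ _ _) Ps _ AP; rewrite ws.
Qed.

Lemma pblock_singletons (G : graph) (u : G) : pblock (singletons G) u = [set u].
Proof.
have /and3P[_ tS _] := singletons_partition G.
by apply: def_pblock tS _ _; [apply: imset_f|rewrite inE].
Qed.

Lemma card_bigcup_le (I T : finType) (N : {set I}) (F : I -> {set T}) m :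
  {in N, forall i, #|F i| <= m} -> #|\bigcup_(i in N) F i| <= #|N| * m.
Proof.
move=> Fm; apply: (@leq_trans (\sum_(i in N) #|F i|)).
  elim/big_ind2: _ => [|x X y Y H1 H2|//]; first by rewrite cards0.
  by apply: leq_trans (leq_card_setU _ _) _; apply: leq_add.
by rewrite -sum_nat_const; apply: leq_sum.
Qed.

Lemma three_ordered k (N : {set 'I_k}) : 2 < #|N| ->
  exists a b c, [/\ a \in N, b \in N, c \in N, (a < b)%N & (b < c)%N].
Proof.
case/card_gt2P => x [y [z [[xN yN zN] [xy yz zx]]]].
move: xy yz zx; rewrite -!(inj_eq val_inj) !neq_ltn /=.
move=> /orP[] h1 /orP[] h2 /orP[] h3.
all: try by [exists z, x, y | exists x, y, z | exists y, z, x
            | exists x, z, y | exists z, y, x | exists y, x, z].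
(* The two cyclic patterns are contradictory. *)
all: by lia.
Qed.

Definition meets k (V : finType) (B : 'I_k -> {set V}) (X : {set V}) : {set 'I_k} :=
  [set l | B l :&: X != set0].

Lemma meetsP k (V : finType) (B : 'I_k -> {set V}) (X : {set V}) l :
  reflect (exists2 v, v \in B l & v \in X) (l \in meets B X).
Proof.
rewrite inE; apply: (iffP (set0Pn _)) => [[v]|[v vB vX]].
  by rewrite inE => /andP[vB vX]; exists v.
by exists v; rewrite inE vB.
Qed.

(** An interval that meets three blocks contains the middle one. *)
Lemma meets_le2 k (G : graph) (pos : G -> nat) (B : 'I_k -> {set G}) (X : {set G}) :
  (forall i j : 'I_k, i < j -> before pos (B i) (B j)) ->
  convex_for pos X -> (forall i, ~~ (B i \subset X)) -> #|meets B X| <= 2.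
Proof.
move=> ordB cX nX; rewrite leqNgt; apply/negP => /three_ordered[a [b [c]]].
case=> /meetsP[u uB uX] _ /meetsP[w wB wX] ab bc.
case/negP: (nX b); apply/subsetP => v vB; apply: (cX u w v uX wX).
by apply/andP; split; apply: ltnW;
  [exact: (beforeP _ _ _ (ordB _ _ ab))|exact: (beforeP _ _ _ (ordB _ _ bc))].
Qed.

(** [Z = A :|: C] is the first part to swallow a block [B j].  A block not meeting
    [Z] has a vertex that splits [B j], and hence lies in a part impure to [Z];
    that part, and likewise [A] and [C], meets at most two blocks. *)
Lemma mixed_parts_bound k t (G : graph) (P : {set {set G}}) (A C : {set G}) (pos : G -> nat)
    (B : 'I_k -> {set G}) (j : 'I_k) (Q := contract P A C) :
  partition Q [set: G] -> impure_degree Q (A :|: C) <= t ->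
  (forall X, X \in P -> convex_for pos X) -> A \in P -> C \in P ->
  (forall i j : 'I_k, i < j -> before pos (B i) (B j)) ->
  (forall i, B i != set0) ->
  (forall i j, i != j -> splits (@adj G) (B i) (B j)) ->
  (forall X i, X \in P -> ~~ (B i \subset X)) ->
  B j \subset A :|: C -> k <= 2 * t + 4.
Proof.
move=> pQ dQ cvx AP CP ordB B0 spl nB jZ.
have le2 X : X \in P -> #|meets B X| <= 2.
  by move=> XP; apply: meets_le2 ordB (cvx X XP) _ => i; apply: nB.
pose N := [set X in Q | (X != A :|: C) && impure (A :|: C) X].
have /and3P[/eqP covQ tQ Q0] := pQ.
have cover l : l \in meets B A :|: meets B C :|: \bigcup_(X in N) meets B X.
  rewrite !in_setU; have [//|nA] := boolP (l \in meets B A).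
  have [//|nC] := boolP (l \in meets B C); rewrite /=.
  have nZ v : v \in B l -> v \notin A :|: C.
    move=> vl; rewrite inE negb_or; apply/andP; split.
      by apply: contra nA => vA; apply/meetsP; exists v.
    by apply: contra nC => vC; apply/meetsP; exists v.
  have lj : l != j.
    apply/eqP => E; have /set0Pn[v vB] := B0 j.
    by have := nZ v; rewrite E vB (subsetP jZ) // => /(_ isT).
  have /splitsP[v [a [b [vB aB bB vab]]]] := spl _ _ lj.
  have vX : v \in pblock Q v by rewrite mem_pblock covQ inE.
  apply/bigcupP; exists (pblock Q v); last by apply/meetsP; exists v.
  have aZ := subsetP jZ a aB; have bZ := subsetP jZ b bB.
  rewrite in_set pblock_mem ?covQ ?inE //=; apply/andP; split.
    by apply: contraNneq (nZ v vB) => <-.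
  rewrite /impure /pure negb_or; apply/andP; split.
    apply: contra vab => /forall_inP H.
    by rewrite ![adj v _]adj_sym (forall_inP (H a aZ) v vX) (forall_inP (H b bZ) v vX).
  apply: contra vab => /forall_inP H.
  rewrite ![adj v _]adj_sym (negbTE (forall_inP (H a aZ) v vX)).
  by rewrite (negbTE (forall_inP (H b bZ) v vX)).
have <- : #|meets B A :|: meets B C :|: \bigcup_(X in N) meets B X| = k.
  by rewrite -[RHS]card_ord; apply: eq_card => l; rewrite cover.
apply: leq_trans (leq_card_setU _ _) _; rewrite addnC leq_add //.
  apply: leq_trans (_ : #|N| * 2 <= _); last by rewrite mulnC leq_mul2l dQ.
  apply: card_bigcup_le => X; rewrite in_set => /andP[XQ /andP[XZ _]].
  by apply: le2; case: (mem_contract XQ) => // E; case/eqP: XZ.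
exact: leq_trans (leq_card_setU _ _) (leq_add (le2 A AP) (le2 C CP)).
Qed.

(** Singletons swallow no block, because each block is split by the others, and the
    whole vertex set swallows them all; [mixed_parts_bound] applies at the first
    change. *)
Lemma twin_width_minor_free (G : graph) t : twin_width G <= t ->
  exists2 pos : G -> nat, proper_pos (@adj G) pos &
    minor_free (@adj G) pos (2 * t + 5) [set: G].
Proof.
case/twin_width_sequence => s [alls pth lst deg].
have [pos [posE cvx]] := contraction_order alls pth lst.
exists pos => [u v uv|].
  rewrite posE pblock_singletons inE; apply: contraTneq uv => ->.
  by rewrite adj_irrefl.
move=> bs /andP[bs0 bsp] _; rewrite ltnNge; apply/negP => sz.
have k2 : 1 < size bs by apply: leq_trans sz; clear; lia.
pose B (i : 'I_(size bs)) := nth set0 bs i.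
have ordM (i j : 'I_(size bs)) : i < j -> before pos (B i) (B j) && mixed (@adj G) (B i) (B j).
  by move=> ij; apply: (pairwiseP set0 bsp); rewrite // inE.
have ordB (i j : 'I_(size bs)) : i < j -> before pos (B i) (B j).
  by move=> /ordM/andP[].
have B0 i : B i != set0 by apply: contraNneq bs0 => <-; apply: mem_nth.
have spl i j : i != j -> splits (@adj G) (B i) (B j).
  rewrite -(inj_eq val_inj) neq_ltn => /orP[] /ordM /andP[_ /andP[]] //.
pose swallows (P : {set {set G}}) := [exists X in P, exists i, B i \subset X].
have swallowsPn P X i : ~~ swallows P -> X \in P -> ~~ (B i \subset X).
  move=> nP XP; apply: contra nP => BX; apply/exists_inP; exists X => //.
  by apply/existsP; exists i.
pose i0 := Ordinal (ltnW k2); pose i1 := Ordinal k2.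
have first_ok : ~~ swallows (singletons G).
  apply/exists_inP => -[_ /imsetP[x _ ->] /existsP[i /subsetP Bx]].
  have [j ji] : exists j, j != i.
    by have [<-|] := eqVneq i0 i; [exists i1|exists i0].
  have /splitsP[v [a [b [_ /Bx + /Bx]]]] := spl _ _ ji.
  by rewrite !inE => /eqP-> /eqP->; rewrite eqxx.
have last_bad : swallows (last (singletons G) s).
  rewrite lst; apply/exists_inP; exists setT; rewrite ?inE //.
  by apply/existsP; exists i0; apply: subsetT.
have [P [Q [Ps Qs PQ nP /exists_inP[Z ZQ /existsP[j BZ]]]]] :=
  path_crossing pth first_ok last_bad.
have /contracts_toP[A [C [AP CP AC eQ]]] := PQ.
have eZ : Z = A :|: C.
  move: ZQ; rewrite eQ => /mem_contract[//|ZP].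
  by case/negP: (swallowsPn P Z j nP ZP).
have pQ : partition Q [set: G] by exact: (allP alls).
rewrite eQ in pQ Qs; rewrite eZ in BZ.
have Zin : A :|: C \in contract P A C by rewrite setU11.
have := mixed_parts_bound pQ (deg _ _ Qs Zin) (fun X => cvx P X Ps) AP CP ordB B0 spl
  (fun X i => swallowsPn P X i nP) BZ.
by move: sz; clear; move: (size bs); lia.
Qed.

(** * Chromatic number of graphs of bounded twin-width *)

Lemma chromatic_number_le (G : graph) k :
  colorable_in (@adj G) [set: G] k -> chromatic_number G <= k.
Proof.
case=> f [fk fp]; rewrite /chromatic_number; case: ex_minnP => m _; apply.
apply/existsP; exists [ffun x => Ordinal (fk x (in_setT x))].
apply/forallP => x; apply/forallP => y; apply/implyP => xy; rewrite !ffunE.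
by apply/eqP => /(congr1 val); apply: fp; rewrite ?inE.
Qed.

Lemma omega_clique_number (G : graph) : omega (@adj G) [set: G] <= clique_number G.
Proof.
apply/omega_leP => K cK _; rewrite /clique_number.
exact: (@bigmax_sup _ K _ #|K| (fun K => #|K|)).
Qed.

Lemma colorable_anticomplete (V : finType) (e : rel V) (A B : {set V}) k :
  symmetric e -> {in A & B, forall a b, ~~ e a b} ->
  colorable_in e A k -> colorable_in e B k -> colorable_in e (A :|: B) k.
Proof.
move=> e_sym AB [f [fk fp]] [g [gk gp]].
exists (fun u => if u \in A then f u else g u); split=> [u|u v]; rewrite !inE.
  by case: ifP => [uA _|_ uB]; [exact: fk|exact: gk].
case: ifPn => [uA _|_ uB]; case: ifPn => [vA _|_ vB] uv.
- exact: fp.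
- by have := AB u v uA vB; rewrite uv.
- by have := AB v u vA uB; rewrite e_sym uv.
- exact: gp.
Qed.

(** Contracting a complete pair adds both the numbers of colors and the clique
    numbers; contracting an anticomplete pair takes the maximum of both. *)
Lemma pure_sequence_colorable (G : graph) (P : {set {set G}}) s :
  (forall Q A, Q \in P :: s -> A \in Q -> impure_degree Q A <= 0) ->
  path (@contracts_to G) P s ->
  {in P, forall A, colorable_in (@adj G) A (omega (@adj G) A)} ->
  {in last P s, forall A, colorable_in (@adj G) A (omega (@adj G) A)}.
Proof.
elim: s P => [|Q s IH] P //= deg /andP[/contracts_toP[A [B [AP BP AB eQ]]] pth] colP.
apply: IH pth _ => [Q' C Q's|Z]; first by apply: deg; rewrite in_cons Q's orbT.
rewrite eQ => /mem_contract[->|]; last exact: colP.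
have : pure A B.
  have := deg P A (mem_head _ _) AP; rewrite leqn0 cards_eq0 => /eqP/setP/(_ B).
  by rewrite !inE BP eq_sym AB /= /impure => /negbFE.
have irr : irreflexive (@adj G) by exact: adj_irrefl.
have sy : symmetric (@adj G) by exact: adj_sym.
case/orP => [/forall_inP cAB|/forall_inP aAB].
  apply: (colorable_le (subxx _) _ (colorableU (subxx _) (colP A AP) (colP B BP))).
  apply: omega_join; rewrite ?subsetUl ?subsetUr // => a b aA bB.
  exact: (forall_inP (cAB a aA)).
apply: colorable_anticomplete => //.
- by move=> a b aA bB; apply: (forall_inP (aAB a aA)).
- by apply: colorable_le (colP A AP); rewrite ?omegaS ?subsetUl.
- by apply: colorable_le (colP B BP); rewrite ?omegaS ?subsetUr.
Qed.

Lemma twin_width0_colorable (G : graph) : twin_width G <= 0 ->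
  chromatic_number G <= clique_number G.
Proof.
case/twin_width_sequence => s [alls pth lst deg].
apply: leq_trans (omega_clique_number G); apply: chromatic_number_le.
apply: (pure_sequence_colorable deg pth); last by rewrite lst inE.
move=> _ /imsetP[x _ ->]; apply: (@colorable_le _ _ _ [set x] 1) => //.
  by apply: (@omega_gt0 _ _ _ x); rewrite inE.
apply: colorable_independent => u v; rewrite !inE => /eqP-> /eqP->.
by rewrite adj_irrefl.
Qed.

Lemma chromatic_number_bound t : exists g p, p <= 4 * t + 3 /\
  forall (G : graph) n, twin_width G <= t -> clique_number G < 2 ^ n ->
    chromatic_number G <= 2 ^ (g * n ^ p).
Proof.
case: t => [|t].
  exists 1, 1; split=> // G n tw cl; rewrite mul1n expn1.
  exact: leq_trans (twin_width0_colorable tw) (ltnW cl).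
exists (bound_coef (2 * t.+1 + 4)), (2 * t.+1 + 4).+1; split; first lia.
move=> G n tw cl; have [pos ppos free] := twin_width_minor_free tw.
apply: chromatic_number_le; apply: (coloring_bound (pos := pos)) => //.
- exact: adj_sym.
- exact: leq_ltn_trans (omega_clique_number G) cl.
- by rewrite -addnS.
Qed.

(** * From powers of two to logarithms *)

Import Order.TTheory GRing.Theory Num.Theory.

(** The number of binary digits of [w] is at most [1 + log2 w], hence at most
    [2 * log2 w] as [1 < w]; this is where the factor [2 ^ p] comes from. *)
Lemma quasi_power_of_log2 (R : realType) (chi w g p m : nat) :
  (p <= m)%N -> (chi <= 2 ^ (g * (trunc_log 2 w).+1 ^ p))%N ->
  (1 < w)%N ->
  (chi%:R <= (2 : R) `^ ((g * 2 ^ p)%N%:R * log2 (w%:R : R) ^+ m))%R.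
Proof.
move=> pm chi_le w1; have w0 : (0 < w)%N by exact: ltnW.
set n := (trunc_log 2 w).+1 in chi_le *.
have ln2 : (0 < ln (2 : R))%R by rewrite ln_gt0 // ltr1n.
have log_ge (k : nat) : (2 ^ k <= w)%N -> (k%:R <= log2 (w%:R : R))%R.
  move=> kw; rewrite /log2 ler_pdivlMr // mulr_natl -lnXn //.
  by rewrite ler_ln ?posrE ?exprn_gt0 ?ltr0n // -natrX ler_nat.
have L1 : (1 <= log2 (w%:R : R))%R by apply: (log_ge 1%N).
have nL : (n%:R <= 2 * log2 (w%:R : R))%R.
  rewrite /n -addn1 natrD mulr_natl mulr2n lerD //.
  by apply: log_ge; apply: trunc_logP.
have L0 : (0 <= log2 (w%:R : R))%R by apply: le_trans L1.
apply: (@le_trans _ _ ((2 ^ (g * n ^ p))%N%:R)%R); first by rewrite ler_nat.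
rewrite natrX -[X in (X <= _)%R]powR_mulrn ?ler0n //; apply: ler_powR; first by rewrite ler1n.
rewrite !natrM -mulrA ler_wpM2l ?ler0n // !natrX.
apply: (@le_trans _ _ ((2 * log2 (w%:R : R)) ^+ p)%R).
  by apply: lerXn2r nL; rewrite nnegrE //; apply: mulr_ge0.
by rewrite exprMn ler_wpM2l ?exprn_ge0 ?ler0n // ler_weXn2l.
Qed.

Theorem theorem1p1 (R : realType) (t : nat) :
  exists gamma : nat, forall G : graph,
    (twin_width G <= t)%N ->
    ((chromatic_number G)%:R <=
       2 `^ (gamma%:R * log2 ((clique_number G)%:R : R) ^+ (4 * t + 3)))%R.
Proof.
have [g [p [pm chi_bound]]] := chromatic_number_bound t.
exists (g * 2 ^ p)%N => G tw; set w := clique_number G.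
have := chi_bound G _ tw (trunc_log_ltn w (isT : 1 < 2)%N).
(* For [w = 1] the right-hand side is exactly 1, and the graph has no edge. *)
have [w1 _|w1 chi_le] := leqP w 1; last exact: quasi_power_of_log2 pm chi_le w1.
have chi1 : (chromatic_number G <= 1)%N.
  apply/chromatic_number_le/colorable_independent => u v uS vS; apply/negP => uv.
  have := omega_gt1 (@adj_sym G) (@adj_irrefl G) uS vS uv.
  by rewrite ltnNge (leq_trans (omega_clique_number G) w1).
have [x _] : exists x : G, x \in [set: G] by apply/set0Pn; rewrite -card_gt0 cardsT vertex_gt0.
have w_eq1 : w = 1.
  apply/eqP; rewrite eqn_leq w1; apply: leq_trans (omega_clique_number G).
  by apply: (@omega_gt0 _ _ _ x); rewrite inE.
by rewrite w_eq1 /log2 ln1 mul0r expr0n addn3 /= mulr0 powRr0 lern1.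
Qed.
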